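(* Let $b\colon[0,T]\times\mathbb{R}^d\to\mathbb{R}^d$, $\sigma\colon[0,T]\times\mathbb{R}^d\to\mathbb{R}^{d\times d}$, $f\colon[0,T]\times\mathbb{R}^d\times\mathbb{R}\times\mathbb{R}^d\to\mathbb{R}$, $h\colon\mathbb{R}^d\to\mathbb{R}$ be Borel measurable and satisfy, for some positive constants $C,m$ and all $t\in[0,T]$, $x,x',z,z'\in\mathbb{R}^d$, $y,y'\in\mathbb{R}$: $|b(t,x)-b(t,x')|+|\sigma(t,x)-\sigma(t,x')|\le C|x-x'|$; $|f(t,x,y,z)-f(t,x,y',z')|\le C(|y-y'|+|z-z'|)$; $|b(t,0)|+|\sigma(t,0)|\le C$; $|f(t,x,0,0)|+|h(x)|\le C(1+|x|^m)$. Consider the semilinear parabolic PDE $$\begin{cases}\partial_t u+\langle b(t,x),D_xu\rangle+\tfrac12\mathrm{tr}(\sigma\sigma^{\top}(t,x)D_x^2u)+f(t,x,u,\sigma^{\top}(t,x)D_xu)=0,&(t,x)\in[0,T[\times\mathbb{R}^d,\\ u(T,x)=h(x),&x\in\mathbb{R}^d.\end{cases}\qquad(\mathrm{E})$$ Let $\check u\colon[0,T]\times\mathbb{R}^d\to\mathbb{R}$ (resp. $\hat u\colon[0,T]\times\mathbb{R}^d\to\mathbb{R}$) be a strong-viscosity subsolution (resp. strong-viscosity supersolution) to (E). Then $\check u\le\hat u$ on $[0,T]\times\mathbb{R}^d$. In particular, there exists at most one generalized strong-viscosity solution to (E).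
   Context: Fix $T>0$ and an integer $d\ge1$. $|\cdot|$ is the absolute value, Euclidean norm, or Frobenius norm. Classical sub/supersolution: $u\colon[0,T]\times\mathbb{R}^d\to\mathbb{R}$ is a classical subsolution (resp. supersolution) of the PDE with coefficients $(b,\sigma,f,h)$ if $u\in C^{1,2}([0,T[\times\mathbb{R}^d)\cap C([0,T]\times\mathbb{R}^d)$, $\partial_tu+\langle b,D_xu\rangle+\frac12\mathrm{tr}(\sigma\sigma^\top D_x^2u)+f(t,x,u,\sigma^\top D_xu)\ge0$ (resp. $\le0$) on $[0,T[\times\mathbb{R}^d$, and $u(T,x)\le h(x)$ (resp. $\ge h(x)$) for all $x\in\mathbb{R}^d$. Strong-viscosity supersolution (resp. subsolution) of (E): a function $u\colon[0,T]\times\mathbb{R}^d\to\mathbb{R}$ for which there is a sequence $(u_n,h_n,f_n,b_n,\sigma_n)_n$ of real-, real-, real-, $\mathbb{R}^d$- and $\mathbb{R}^{d\times d}$-valued Borel functions defined on $[0,T]\times\mathbb{R}^d$, $\mathbb{R}^d$, $[0,T]\times\mathbb{R}^d\times\mathbb{R}\times\mathbb{R}^d$, $[0,T]\times\mathbb{R}^d$, $[0,T]\times\mathbb{R}^d$ respectively such that: (i) for some positive constants $C,m$ independent of $n$, for all arguments, $|b_n(t,x)-b_n(t,x')|+|\sigma_n(t,x)-\sigma_n(t,x')|\le C|x-x'|$, $|f_n(t,x,y,z)-f_n(t,x,y',z')|\le C(|y-y'|+|z-z'|)$, $|b_n(t,0)|+|\sigma_n(t,0)|\le C$, $|u_n(t,x)|+|h_n(x)|+|f_n(t,x,0,0)|\le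 C(1+|x|^m)$; moreover the functions $u_n(t,\cdot)$, $h_n(\cdot)$, $f_n(t,\cdot,\cdot,\cdot)$, $n\in\mathbb{N}$, are equicontinuous on compact sets, uniformly with respect to $t\in[0,T]$; (ii) $u_n$ is a classical supersolution (resp. subsolution) of the PDE with coefficients $(b_n,\sigma_n,f_n,h_n)$; (iii) $(u_n,h_n,f_n,b_n,\sigma_n)$ converges pointwise to $(u,h,f,b,\sigma)$ as $n\to\infty$. A generalized strong-viscosity solution of (E) is a function that is both a strong-viscosity supersolution and a strong-viscosity subsolution of (E). *)

(* Defs.v *)
From mathcomp Require Import all_boot all_order all_algebra.
From mathcomp Require Import all_classical all_reals all_analysis.

Set Implicit Arguments.
Unset Strict Implicit.
Unset Printing Implicit Defensive.

Import Order.TTheory GRing.Theory Num.Theory numFieldNormedType.Exports.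
Local Open Scope classical_set_scope.
Local Open Scope ring_scope.

(* R^d is 'cV[R]_d. A function on [0,T] x R^d (x ...) is a total function of
   the real variable t whose values for t outside [0,T] are never used:
   every condition below is restricted to t in [0,T] (or [0,T[). *)

(* Frobenius norm of a matrix; Euclidean norm on column vectors. The library
   norm `|A| on matrices is the max norm. *)
Definition frob (R : realType) (m n : nat) (A : 'M[R]_(m, n)) : R :=
  Num.sqrt (\sum_i \sum_j A i j ^+ 2).

Definition dotv (R : realType) (d : nat) (p q : 'cV[R]_d) : R :=
  \sum_i p i 0 * q i 0.

(* Measurability on D for the sigma-algebras generated by the open sets. *)
Definition borel_fun (R : realType) (X Y : normedModType R) (D : set X)
    (g : X -> Y) : Prop :=
  measurable_fun (D : set (g_sigma_algebraType (@open X)))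
    (g : g_sigma_algebraType (@open X) -> g_sigma_algebraType (@open Y)).

(* One common modulus of continuity on each compact set for the whole family
   (F i), i in W. The choice of norm on V (here the max norm of the library)
   is immaterial, V being finite-dimensional in all uses. *)
Definition equicontinuous_on_compacts (R : realType) (V : normedModType R)
    (I : Type) (W : set I) (F : I -> V -> R) : Prop :=
  forall K : set V, compact K -> forall e : R, 0 < e ->
  exists2 delta : R, 0 < delta &
    forall i x x', W i -> K x -> K x' ->
      `|x - x'| < delta -> `|F i x - F i x'| < e.

Section StrongViscosity.
Context (R : realType) (d : nat) (T : R).
Local Notation E := 'cV[R]_d.

Definition strip : set (R * E) := [set p | 0 <= p.1 <= T].
Definition strip_open : set (R * E) := [set p | 0 <= p.1 < T].
Definition strip_gen : set (R * E * R * E) := [set p | 0 <= p.1.1.1 <= T].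

Section Derivatives.
Variable u : R -> E -> R.

(* Difference quotient with s ranging over [0,T] only, so that the time
   derivative is the right derivative at t = 0. *)
Definition time_quot (t : R) (x : E) (s : R) : R :=
  (s - t)^-1 * (u s x - u t x).

Definition time_derivable (t : R) (x : E) : Prop :=
  cvg (time_quot t x s @[s --> within `[0, T]%classic t^']).

Definition dt (t : R) (x : E) : R :=
  lim (time_quot t x s @[s --> within `[0, T]%classic t^']).

Definition dx (i : 'I_d) (t : R) (x : E) : R := 'D_(delta_mx i 0) (u t) x.

Definition dxx (i j : 'I_d) (t : R) (x : E) : R :=
  'D_(delta_mx i 0) (dx j t) x.

Definition grad (t : R) (x : E) : E := \col_i dx i t x.

Definition hess (t : R) (x : E) : 'M[R]_d := \matrix_(i, j) dxx i j t x.

(* C^{1,2}([0,T[ x R^d) /\ C([0,T] x R^d) *)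
Record C12 : Prop := {
  C12_cont : {within strip, continuous (fun p => u p.1 p.2)};
  C12_dt : forall (t : R) (x : E), 0 <= t < T -> time_derivable t x;
  C12_dt_cont : {within strip_open, continuous (fun p => dt p.1 p.2)};
  C12_dx : forall (t : R) (x : E) (i : 'I_d), 0 <= t < T ->
    derivable (u t) x (delta_mx i 0);
  C12_dx_cont : forall i,
    {within strip_open, continuous (fun p => dx i p.1 p.2)};
  C12_dxx : forall (t : R) (x : E) (i j : 'I_d), 0 <= t < T ->
    derivable (dx j t) x (delta_mx i 0);
  C12_dxx_cont : forall i j,
    {within strip_open, continuous (fun p => dxx i j p.1 p.2)}
}.

End Derivatives.

Definition parabolic_op (b : R -> E -> E) (sigma : R -> E -> 'M[R]_d)
    (f : R -> E -> R -> E -> R) (u : R -> E -> R) (t : R) (x : E) : R :=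
  dt u t x + dotv (b t x) (grad u t x)
  + 2^-1 * \tr (sigma t x *m (sigma t x)^T *m hess u t x)
  + f t x (u t x) ((sigma t x)^T *m grad u t x).

Definition classical_subsolution (b : R -> E -> E) (sigma : R -> E -> 'M[R]_d)
    (f : R -> E -> R -> E -> R) (h : E -> R) (u : R -> E -> R) : Prop :=
  [/\ C12 u,
      forall (t : R) (x : E), 0 <= t < T -> 0 <= parabolic_op b sigma f u t x
    & forall x, u T x <= h x].

Definition classical_supersolution (b : R -> E -> E) (sigma : R -> E -> 'M[R]_d)
    (f : R -> E -> R -> E -> R) (h : E -> R) (u : R -> E -> R) : Prop :=
  [/\ C12 u,
      forall (t : R) (x : E), 0 <= t < T -> parabolic_op b sigma f u t x <= 0
    & forall x, h x <= u T x].

Record borel_coefs (b : R -> E -> E) (sigma : R -> E -> 'M[R]_d)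
    (f : R -> E -> R -> E -> R) (h : E -> R) : Prop := {
  borel_b : borel_fun strip (fun p => b p.1 p.2);
  borel_sigma : borel_fun strip (fun p => sigma p.1 p.2);
  borel_f : borel_fun strip_gen (fun p => f p.1.1.1 p.1.1.2 p.1.2 p.2);
  borel_h : borel_fun setT h
}.

Record lipschitz_coefs (C : R) (b : R -> E -> E) (sigma : R -> E -> 'M[R]_d)
    (f : R -> E -> R -> E -> R) : Prop := {
  lip_b_sigma : forall (t : R) (x x' : E), 0 <= t <= T ->
    frob (b t x - b t x') + frob (sigma t x - sigma t x') <= C * frob (x - x');
  lip_f : forall (t : R) (x : E) (y y' : R) (z z' : E),
    0 <= t <= T ->
    `|f t x y z - f t x y' z'| <= C * (`|y - y'| + frob (z - z'));
  bound_b_sigma : forall t : R, 0 <= t <= T ->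
    frob (b t 0) + frob (sigma t 0) <= C
}.

Definition admissible (b : R -> E -> E) (sigma : R -> E -> 'M[R]_d)
    (f : R -> E -> R -> E -> R) (h : E -> R) : Prop :=
  borel_coefs b sigma f h /\
  exists C m : R, [/\ 0 < C, 0 < m, lipschitz_coefs C b sigma f
    & forall (t : R) (x : E), 0 <= t <= T ->
        `|f t x 0 0| + `|h x| <= C * (1 + frob x `^ m)].

(* [classical] is classical_subsolution or classical_supersolution. *)
Definition strong_viscosity
    (classical : (R -> E -> E) -> (R -> E -> 'M[R]_d) ->
      (R -> E -> R -> E -> R) -> (E -> R) -> (R -> E -> R) -> Prop)
    (b : R -> E -> E) (sigma : R -> E -> 'M[R]_d)
    (f : R -> E -> R -> E -> R) (h : E -> R) (u : R -> E -> R) : Prop :=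
  exists (un : nat -> R -> E -> R) (hn : nat -> E -> R)
    (fn : nat -> R -> E -> R -> E -> R)
    (bn : nat -> R -> E -> E) (sn : nat -> R -> E -> 'M[R]_d),
  (forall n, borel_fun strip (fun p => un n p.1 p.2) /\
             borel_coefs (bn n) (sn n) (fn n) (hn n)) /\
  (exists C m : R, [/\ 0 < C, 0 < m,
      forall n, lipschitz_coefs C (bn n) (sn n) (fn n)
    & forall (n : nat) (t : R) (x : E), 0 <= t <= T ->
        `|un n t x| + `|hn n x| + `|fn n t x 0 0|
          <= C * (1 + frob x `^ m)]) /\
  [/\ equicontinuous_on_compacts [set i : nat * R | 0 <= i.2 <= T]
        (fun i x => un i.1 i.2 x),
      equicontinuous_on_compacts [set: nat] hn
    & equicontinuous_on_compacts [set i : nat * R | 0 <= i.2 <= T]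
        (fun i (p : E * R * E) => fn i.1 i.2 p.1.1 p.1.2 p.2)] /\
  (forall n, classical (bn n) (sn n) (fn n) (hn n) (un n)) /\
  (forall (t : R) (x : E), 0 <= t <= T ->
    [/\ un n t x @[n --> \oo] --> u t x,
        bn n t x @[n --> \oo] --> b t x,
        sn n t x @[n --> \oo] --> sigma t x
      & forall y z, fn n t x y z @[n --> \oo] --> f t x y z]) /\
  (forall x, hn n x @[n --> \oo] --> h x).

Definition sv_subsolution (b : R -> E -> E) (sigma : R -> E -> 'M[R]_d)
    (f : R -> E -> R -> E -> R) (h : E -> R) (u : R -> E -> R) : Prop :=
  strong_viscosity classical_subsolution b sigma f h u.

Definition sv_supersolution (b : R -> E -> E) (sigma : R -> E -> 'M[R]_d)
    (f : R -> E -> R -> E -> R) (h : E -> R) (u : R -> E -> R) : Prop :=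
  strong_viscosity classical_supersolution b sigma f h u.

Definition generalized_sv_solution (b : R -> E -> E)
    (sigma : R -> E -> 'M[R]_d) (f : R -> E -> R -> E -> R) (h : E -> R)
    (u : R -> E -> R) : Prop :=
  sv_supersolution b sigma f h u /\ sv_subsolution b sigma f h u.

End StrongViscosity.

(* Main.v *)
(* Let w and v be approximations, with close coefficients, of a subsolution and
   of a supersolution. At a maximum (t, x, y) of
     e^(mu t) (w(t,x) - v(t,y) + gam (v(t,y) - A)^2 - |x-y|^2 / (2 eps))
       - del ((1+|x|^2)^k + (1+|y|^2)^k) - F(t)
   the first and second order conditions along the columns of the two diffusion
   matrices, combined with the two differential inequalities, bound the slope
   of -F at t in terms of the distance between the coefficients at time t. The term gam (v-A)^2 contributes gam |z|^2, where
   z = sigma^T Dv, with a favourable sign; it absorbs the generators for large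
   z, where their equicontinuity in x is of no help, while for bounded z local
   equicontinuity is enough. The coefficients of the two approximations have
   the same pointwise limits, hence by Egorov's theorem and a finite net they
   are uniformly close on compact sets outside an open set O of times of small
   measure; F has slope at most -K on O and at most -tau elsewhere, with K as
   large as needed, and stays small because O has small measure. This
   contradicts the bound on the slope, unless the maximum is attained at time
   T, where the terminal conditions exclude it. *)
Require Import Defs.
From mathcomp Require Import all_boot all_order all_algebra.
From mathcomp Require Import all_classical all_reals all_analysis.
From mathcomp Require Import measurable_realfun ring lra.
Set Implicit Arguments.
Unset Strict Implicit.
Unset Printing Implicit Defensive.
Import Order.TTheory GRing.Theory Num.Theory numFieldNormedType.Exports.
Local Open Scope classical_set_scope.
Local Open Scope ring_scope.

(** The argument closes because of the order in which the constants are fixed. The weight [del] and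
    the growth bounds, common to all indices, give a radius [r] for the maximum points and a bound
    [A] for both functions there. Then [gam] is taken so small that its own errors, of size [gam]
    times a quantity depending on [A], are harmless, and [N] is the gradient size beyond which
    [gam |z|^2] wins. The common moduli on the compact sets given by [r], [A], [N] yield [rho] for a
    tolerance [eta]; [rho] gives [eps], [eps] gives the required closeness [zeta] of the
    coefficients, [eps] and [N] give the slope K, K gives the measure allowed for O, and the index n
    comes last. So [eps] precedes n and cannot be sent to 0 for a fixed pair of functions. Instead
    of tending to 0, |x-y|^2 / [eps] is bounded by [6 * eta], through equicontinuity uniform in n.
    Derivatives of the approximations have no bound uniform in n; they are controlled only through
    the optimality conditions. On O only crude bounds on the coefficients remain, and they enter
    with a factor 1/[eps], which is why K must be known before O is chosen. *)

Lemma is_derive_cvgP (R : realType) (V : normedModType R) (g : V -> R)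
    (x v : V) (l : R) :
  is_derive x v g l <->
  (h^-1 *: (g (h *: v + x) - g x)) @[h --> 0^'] --> l.
Proof.
split; first by case=> + <-; rewrite /derivable.
by move=> gl; split; [apply/cvg_ex; exists l|apply: cvg_lim].
Qed.

(** * Directional derivatives from continuous partial derivatives *)

Section DirectionalDerivatives.
Variables (R : realType) (V : normedModType R).
Implicit Types (g : V -> R) (x u v : V).

Lemma is_derive_line g x v (s : R) (l : R) :
  is_derive (x + s *: v) v g l -> is_derive s 1 (fun r => g (x + r *: v)) l.
Proof.
move=> /is_derive_cvgP gl; apply/is_derive_cvgP; apply: cvg_trans gl.
apply: near_eq_cvg; near=> h; congr (_ *: (g _ - _)).
by rewrite [h%:A]mulr1 scalerDl addrCA.
Unshelve. all: by end_near. Qed.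

Lemma is_deriveZv g x v (a l : R) :
  is_derive x v g l -> is_derive x (a *: v) g (a * l).
Proof.
have [->|a0] := eqVneq a 0; first by rewrite scale0r mul0r => _; exact: is_derive0.
move=> /is_derive_cvgP gl; apply/is_derive_cvgP.
have ha : (h * a) @[h --> (0:R)^'] --> (0:R)^'.
  move=> A [/= e e0 eA]; exists (e / `|a|) => /=; first by rewrite divr_gt0 ?normr_gt0.
  move=> h /=; rewrite sub0r normrN ltr_pdivlMr ?normr_gt0// -normrM => he h0.
  by apply: eA => /=; [rewrite sub0r normrN|rewrite mulf_neq0].
have G : a * ((h * a)^-1 *: (g ((h * a) *: v + x) - g x)) @[h --> (0:R)^'] --> a * l.
  by apply: cvgM; [exact: cvg_cst|exact: cvg_comp ha gl].
apply: cvg_trans G.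
apply: near_eq_cvg; near=> h.
have h0 : h != 0 by near: h; exact: nbhs_dnbhs_neq.
rewrite scalerA /GRing.scale/= mulrA; congr (_ * _); field.
by rewrite a0 h0.
Unshelve. all: by end_near. Qed.

(** The increment splits at [h *: u + x]. The mean value theorem along [v] turns the second piece
    into [h] times [Dv] at a point that tends to [x], and continuity of [Dv] at [x] concludes. *)
Lemma is_derive_addv g (Dv : V -> R) x u v (l : R) :
  (forall y, is_derive y v g (Dv y)) -> {for x, continuous Dv} ->
  is_derive x u g l -> is_derive x (u + v) g (l + Dv x).
Proof.
move=> gv Dc /is_derive_cvgP gu; apply/is_derive_cvgP.
have mv h : exists2 c, c \in `[0, 1] &
    g (h *: (u + v) + x) - g (h *: u + x) = h * Dv (h *: u + x + (c * h) *: v).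
  pose f (r : R) := g (h *: u + x + r *: (h *: v)).
  have df (r : R) : is_derive r 1 f (h * Dv (h *: u + x + (r * h) *: v)).
    by apply: is_derive_line; rewrite -scalerA; apply: is_deriveZv.
  have [|c c01] := @MVT_segment R f
    (fun r => h * Dv (h *: u + x + (r * h) *: v)) 0 1 ler01 (fun r _ => df r).
    by apply: derivable_within_continuous => r _; case: (df r).
  rewrite subr0 mulr1 => E; exists c => //; rewrite -E /f scale1r scale0r addr0.
  by rewrite scalerDr -addrA [h *: v + x]addrC addrA.
suff R1 : h^-1 *: (g (h *: (u + v) + x) - g (h *: u + x)) @[h --> (0:R)^'] --> Dv x.
  have G : h^-1 *: (g (h *: u + x) - g x)
      + h^-1 *: (g (h *: (u + v) + x) - g (h *: u + x)) @[h --> (0:R)^'] --> l + Dv x.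
    exact: cvgD gu R1.
  apply: cvg_trans G; apply: near_eq_cvg; near=> h.
  by rewrite /= -scalerDr; congr (_ *: _); rewrite addrC addrA subrK.
apply/cvgrPdist_lt => e e0.
have /cvgrPdist_lt/(_ e e0)/nbhs_normP[/= r r0 rP] := Dc.
(* The intermediate point differs from [x] by [h *: u + (c * h) *: v] with [c] in [0,1], of norm at
   most |h| [M]; the 1 keeps [M] positive. *)
pose M := `|u| + `|v| + 1.
have M0 : 0 < M by rewrite ltr_wpDl ?addr_ge0.
near=> h.
have h0 : h != 0 by near: h; exact: nbhs_dnbhs_neq.
have hr : `|h| < r / M by near: h; apply: dnbhs0_lt; exact: divr_gt0.
have [c] := mv h; rewrite in_itv /= => /andP[c0 c1] ->.
rewrite scalerA mulVf// scale1r; apply: rP => /=.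
rewrite [h *: u + x]addrC -addrA opprD addrA subrr sub0r normrN.
apply: (le_lt_trans (ler_normD _ _)); rewrite !normrZ (ger0_norm c0).
apply: (@le_lt_trans _ _ (`|h| * M)); last by rewrite -ltr_pdivlMr.
rewrite !mulrDr mulr1 -addrA lerD2l -[leLHS]addr0 lerD// -mulrA.
by rewrite ler_piMl// mulr_ge0.
Unshelve. all: by end_near. Qed.

Lemma is_derive_sumv (n : nat) g (e : 'I_n -> V) (D : 'I_n -> V -> R) (a : 'I_n
  -> R) x :
  (forall i y, is_derive y (e i) g (D i y)) ->
  (forall i, {for x, continuous (D i)}) ->
  is_derive x (\sum_i a i *: e i) g (\sum_i a i * D i x).
Proof.
move=> gD Dc; elim: (index_enum _) => [|i r IHr].
  by rewrite !big_nil; exact: is_derive0.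
rewrite !big_cons addrC [in X in is_derive _ _ _ X]addrC.
apply: (is_derive_addv (Dv := fun y => a i * D i y)) => //.
  by move=> y; exact: is_deriveZv.
by apply: cvgM; [exact: cvg_cst|exact: Dc].
Qed.
End DirectionalDerivatives.

(** * Second-order jets of functions of one real variable at 0 *)

Section TwoJets.
Variable R : realType.
Implicit Types (f g : R -> R).

(** The first derivative is required on the whole line, for the mean value theorem in [jet2_max],
    but is differentiated only at 0. In this form jets are closed under sums and products, so the
    jet of the doubled function is computed by algebra. *)
Definition jet2 f (c a b : R) := f 0 = c /\ exists f' : R -> R,
  [/\ forall s : R, is_derive s 1 f (f' s), f' 0 = a & is_derive (0 : R) 1 f' b].

Lemma jet2_eq f c a b c' a' b' : jet2 f c a b ->
  c = c' -> a = a' -> b = b' -> jet2 f c' a' b'.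
Proof. by move=> fJ <- <- <-. Qed.

Lemma jet2_cst (k : R) : jet2 (fun=> k) k 0 0.
Proof.
split=> //; exists (fun=> 0); split=> // [s|]; exact: is_derive_cst.
Qed.

Lemma jet2D f g c a b c' a' b' : jet2 f c a b -> jet2 g c' a' b' ->
  jet2 (fun s => f s + g s) (c + c') (a + a') (b + b').
Proof.
move=> [<- [f' [fd <- fd2]]] [<- [g' [gd <- gd2]]]; split=> //.
exists (fun s => f' s + g' s); split=> // [s|]; exact: is_deriveD.
Qed.

Lemma jet2M f g c a b c' a' b' : jet2 f c a b -> jet2 g c' a' b' ->
  jet2 (fun s => f s * g s) (c * c') (a * c' + c * a')
    (b * c' + 2 * (a * a') + c * b').
Proof.
move=> [<- [f' [fd <- fd2]]] [<- [g' [gd <- gd2]]]; split=> //.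
exists (fun s => f' s * g s + f s * g' s); split=> // [s|].
  have fs := fd s; have gs := gd s.
  by apply: (is_derive_eq (is_deriveM fs gs)); rewrite /GRing.scale/=; ring.
have fs := fd 0; have gs := gd 0.
apply: (is_derive_eq (is_deriveD (is_deriveM fd2 gs) (is_deriveM fs gd2))).
by rewrite /GRing.scale/=; ring.
Qed.

Lemma jet2Z (k : R) f c a b : jet2 f c a b ->
  jet2 (fun s => k * f s) (k * c) (k * a) (k * b).
Proof.
by move=> fJ; apply: (jet2_eq (jet2M (jet2_cst k) fJ)) => //; ring.
Qed.

Lemma jet2B f g c a b c' a' b' : jet2 f c a b -> jet2 g c' a' b' ->
  jet2 (fun s => f s - g s) (c - c') (a - a') (b - b').
Proof.
move=> fJ gJ; have := jet2D fJ (jet2Z (-1) gJ).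
rewrite !mulN1r => /jet2_eq H.
rewrite (_ : (fun s => f s - g s) = (fun s => f s + -1 * g s)); first exact: H.
by apply/funext => s; rewrite mulN1r.
Qed.

Lemma jet2X f c a b n : jet2 f c a b ->
  jet2 (fun s => f s ^+ n.+2) (c ^+ n.+2) (n.+2%:R * c ^+ n.+1 * a)
    (n.+2%:R * (n.+1%:R * c ^+ n * a ^+ 2 + c ^+ n.+1 * b)).
Proof.
move=> fJ; elim: n => [|n IHn].
  have := jet2M fJ fJ; under eq_fun do rewrite -expr2.
  by move=> /jet2_eq; apply; ring.
have := jet2M IHn fJ; under eq_fun do rewrite -exprSr.
by move=> /jet2_eq; apply; rewrite !exprS ?mulrS; ring.
Qed.

Lemma jet2_affine (c a : R) : jet2 (fun s => c + s * a) c a 0.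
Proof.
split; first by rewrite mul0r addr0.
exists (fun=> a); split=> // [s|]; last exact: is_derive_cst.
have H := @is_derive_id R R s 1.
have K := @is_derive_cst R R R a s 1.
have L := @is_derive_cst R R R c s 1.
apply: (is_derive_eq (is_deriveD L (is_deriveM H K))).
by rewrite /GRing.scale/=; ring.
Qed.

(** For the second-order part: if [b] were positive, [f'], which vanishes at 0, would be positive
    just to the right of 0, and the mean value theorem would give a larger value of [f] there. *)
Lemma jet2_max f c a b : jet2 f c a b -> (forall s, f s <= f 0) ->
  a = 0 /\ b <= 0.
Proof.
move=> [_ [f' [fd f'0 fd2]]] fmax.
have a0 : a = 0.
  have f0 : is_derive (0 : R) 1 f 0.
    by apply: (@derive1_at_max R f (-1) 1 0) => //; rewrite in_itv/=; apply/andP;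
      split; lra.
  by rewrite -f'0 -(@derive_val _ _ _ _ _ _ _ (fd 0)) (@derive_val _ _ _ _ _ _ _ f0).
split=> //; rewrite leNgt; apply/negP => b0.
have /is_derive_cvgP/cvgr_gt/(_ 0 b0) := fd2.
move=> /nbhs_normP[/= e e0 eP].
pose d := e / 2.
have d0 : 0 < d by rewrite divr_gt0.
have f'gt0 s : 0 < s <= d -> 0 < f' s.
  move=> /andP[s0 sd]; have := eP s; rewrite /= sub0r normrN gtr0_norm//.
  have -> : s < e by rewrite (le_lt_trans sd)// ltr_pdivrMr// ltr_pMr// ltr1n.
  move=> /(_ isT (lt0r_neq0 s0)).
  by rewrite f'0 a0 subr0 /GRing.scale/= mulr1 addr0 pmulr_rgt0// invr_gt0.
have [|r rd E] := @MVT R f f' 0 d d0 (fun s _ => fd s).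
  by apply: derivable_within_continuous => s _; case: (fd s).
have := fmax d; rewrite -subr_le0 E leNgt mulr_gt0 ?subr0//.
apply: f'gt0; move: rd; rewrite in_itv/= => /andP[-> /ltW ->]//.
Qed.

End TwoJets.

(** * Frobenius norm, scalar product and traces *)

Section FrobeniusNorm.
Variable R : realType.

Section Matrices.
Variables m n : nat.
Implicit Types A B : 'M[R]_(m, n).

Lemma frob_ge0 A : 0 <= frob A.
Proof. exact: sqrtr_ge0. Qed.

Lemma sqr_frob A : frob A ^+ 2 = \sum_i \sum_j A i j ^+ 2.
Proof. by rewrite sqr_sqrtr// !sumr_ge0// => i _; rewrite sumr_ge0// => j _;
  exact: sqr_ge0. Qed.

Lemma frobN A : frob (- A) = frob A.
Proof.
by congr Num.sqrt; apply: eq_bigr => i _; apply: eq_bigr => j _; rewrite mxE sqrrN.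
Qed.

Lemma frobC A B : frob (A - B) = frob (B - A).
Proof. by rewrite -frobN opprB. Qed.

Lemma frob0 : frob (0 : 'M[R]_(m, n)) = 0.
Proof.
rewrite /frob big1 ?sqrtr0// => i _; rewrite big1// => j _.
by rewrite mxE expr0n.
Qed.

Lemma frobZ (a : R) A : frob (a *: A) = `|a| * frob A.
Proof.
rewrite -sqrtr_sqr -sqrtrM ?sqr_ge0//; congr Num.sqrt; rewrite mulr_sumr.
apply: eq_bigr => i _; rewrite mulr_sumr; apply: eq_bigr => j _.
by rewrite mxE exprMn.
Qed.

Lemma cauchy_schwarz_mx A B : `|\sum_i \sum_j A i j * B i j| <= frob A * frob B.
Proof.
wlog suff H : A / \sum_i \sum_j A i j * B i j <= frob A * frob B.
  rewrite ler_norml H andbT lerNl -(frobN A); apply: le_trans (H _).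
  rewrite -sumrN ler_sum// => i _; rewrite -sumrN ler_sum// => j _.
  by rewrite mxE mulNr.
set p := \sum_i _; set a := frob A; set b := frob B.
have a0 : 0 <= a := frob_ge0 A; have b0 : 0 <= b := frob_ge0 B.
(* The right-hand side is the sum of the squares of [b * A i j - a * B i j]. Dividing by [a * b] is
   possible unless one of the norms is 0, in which case that matrix vanishes entrywise. *)
have key : 0 <= 2 * (a * b) * (a * b - p).
  have -> : 2 * (a * b) * (a * b - p)
      = b ^+ 2 * (\sum_i \sum_j A i j ^+ 2) - 2 * (a * b) * p
        + a ^+ 2 * (\sum_i \sum_j B i j ^+ 2).
    by rewrite -!sqr_frob -/a -/b; ring.
  rewrite /p !mulr_sumr -sumrN -!big_split/= sumr_ge0// => i _.
  rewrite !mulr_sumr -sumrN -!big_split/= sumr_ge0// => j _.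
  by rewrite (_ : _ + _ = (b * A i j - a * B i j) ^+ 2) ?sqr_ge0//; ring.
have [ab0|ab0] := eqVneq (a * b) 0; last first.
  by move: key; rewrite pmulr_rge0 ?subr_ge0// mulr_gt0// lt_neqAle eq_sym ab0 mulr_ge0.
rewrite ab0 /p big1// => i _; rewrite big1// => j _; apply/eqP.
have entry0 (M : 'M[R]_(m, n)) : frob M = 0 -> M i j = 0.
  move=> M0; have := sqr_frob M; rewrite M0 expr0n/= => /esym/eqP.
  rewrite psumr_eq0; last by move=> k _; rewrite sumr_ge0// => l _; exact: sqr_ge0.
  move=> /allP/(_ i (mem_index_enum _)); rewrite psumr_eq0; last by move=> l _;
    exact: sqr_ge0.
  by move=> /allP/(_ j (mem_index_enum _)); rewrite sqrf_eq0 => /eqP.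
by move/eqP: ab0; rewrite !mulf_eq0 => /orP[] /eqP/entry0 ->; rewrite eqxx ?orbT.
Qed.

Lemma frobD A B : frob (A + B) <= frob A + frob B.
Proof.
rewrite -ler_sqr ?nnegrE ?addr_ge0 ?frob_ge0// sqrrD !sqr_frob.
rewrite (eq_bigr (fun i => \sum_j A i j ^+ 2 + 2 * (\sum_j A i j * B i j)
    + \sum_j B i j ^+ 2)); last first.
  move=> i _; rewrite mulr_sumr -!big_split; apply: eq_bigr => j _ /=.
  by rewrite mxE; ring.
rewrite !big_split/= lerD2r lerD2l -mulr_sumr -[leRHS]mulr_natl ler_pM2l//.
exact: le_trans (ler_norm _) (cauchy_schwarz_mx _ _).
Qed.

Lemma frobB A B : frob (A - B) <= frob A + frob B.
Proof. by rewrite -(frobN B); exact: frobD. Qed.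

Lemma frob_le_sum A : frob A <= \sum_i \sum_j `|A i j|.
Proof.
have s0 : 0 <= \sum_i \sum_j `|A i j| by rewrite !sumr_ge0// => i _; rewrite sumr_ge0.
rewrite -ler_sqr ?nnegrE ?frob_ge0// sqr_frob.
have sq (I : finType) (c : I -> R) : (forall i, 0 <= c i) ->
    \sum_i c i ^+ 2 <= (\sum_i c i) ^+ 2.
  move=> c0; rewrite [leRHS]expr2 mulr_suml ler_sum// => i _.
  rewrite expr2 ler_wpM2l// (bigD1 i)//= lerDl sumr_ge0//.
apply: le_trans (sq _ _ _) => [|i]; last by rewrite sumr_ge0.
rewrite ler_sum// => i _; apply: le_trans (sq _ _ _) => //.
by rewrite ler_sum// => j _; rewrite real_normK ?num_real.
Qed.

Lemma normr_le_frob A : `|A| <= frob A.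
Proof.
rewrite [leLHS]/Num.norm/= mx_normrE; apply/bigmax_leP; split=> [|[i j] _]; first
  exact: frob_ge0.
rewrite /= -ler_sqr ?nnegrE ?frob_ge0// sqr_frob real_normK ?num_real//.
rewrite (bigD1 i)//= (bigD1 j)//= -addrA lerDl addr_ge0// !sumr_ge0// => k _.
  exact: sqr_ge0.
by rewrite sumr_ge0// => l _; exact: sqr_ge0.
Qed.

End Matrices.

Section Vectors.
Variable d : nat.
Implicit Types (p q : 'cV[R]_d) (s : 'M[R]_d).

Lemma dotvC p q : dotv p q = dotv q p.
Proof. by apply: eq_bigr => i _; rewrite mulrC. Qed.

Lemma dotvDl p p' q : dotv (p + p') q = dotv p q + dotv p' q.
Proof. by rewrite -big_split; apply: eq_bigr => i _; rewrite mxE mulrDl. Qed.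

Lemma dotvZl (a : R) p q : dotv (a *: p) q = a * dotv p q.
Proof. by rewrite mulr_sumr; apply: eq_bigr => i _; rewrite mxE mulrA. Qed.

Lemma dotvBl p p' q : dotv (p - p') q = dotv p q - dotv p' q.
Proof. by rewrite -scaleN1r dotvDl dotvZl mulN1r. Qed.

Lemma dotvDr p q q' : dotv p (q + q') = dotv p q + dotv p q'.
Proof. by rewrite dotvC dotvDl !(dotvC p). Qed.

Lemma dotvZr (a : R) p q : dotv p (a *: q) = a * dotv p q.
Proof. by rewrite dotvC dotvZl dotvC. Qed.

Lemma dotvv p : dotv p p = frob p ^+ 2.
Proof. by rewrite sqr_frob; apply: eq_bigr => i _; rewrite big_ord1 expr2. Qed.

Lemma dotvv_ge0 p : 0 <= dotv p p.
Proof. by rewrite dotvv sqr_ge0. Qed.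

Lemma ler_dotv p q : `|dotv p q| <= frob p * frob q.
Proof.
rewrite /dotv (eq_bigr (fun i => \sum_j p i j * q i j)); last first.
  by move=> i _; rewrite big_ord1.
exact: cauchy_schwarz_mx.
Qed.

Lemma mulTmx_dotv s p k : (s^T *m p) k 0 = dotv p (col k s).
Proof. by rewrite mxE; apply: eq_bigr => i _; rewrite !mxE mulrC. Qed.

Lemma sum_dotv_col s p : \sum_k dotv p (col k s) ^+ 2 = frob (s^T *m p) ^+ 2.
Proof.
by rewrite sqr_frob; apply: eq_bigr => k _; rewrite big_ord1 mulTmx_dotv.
Qed.

Lemma sum_dotvv_col s : \sum_k dotv (col k s) (col k s) = frob s ^+ 2.
Proof.
rewrite sqr_frob exchange_big; apply: eq_bigr => k _; apply: eq_bigr => i _.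
by rewrite mxE expr2.
Qed.

Lemma frob_mulTmx s p : frob (s^T *m p) <= frob s * frob p.
Proof.
rewrite -ler_sqr ?nnegrE ?mulr_ge0 ?frob_ge0// -sum_dotv_col exprMn.
rewrite -sum_dotvv_col mulr_suml ler_sum// => k _.
rewrite dotvv -exprMn -real_normK ?num_real// ler_sqr ?nnegrE ?mulr_ge0 ?frob_ge0//.
by rewrite mulrC ler_dotv.
Qed.

Definition qform (H : 'M[R]_d) p := \sum_i \sum_j p i 0 * p j 0 * H i j.

Lemma trace_qform s (H : 'M[R]_d) :
  \tr (s *m s^T *m H) = \sum_k qform H (col k s).
Proof.
rewrite /mxtrace.
under eq_bigr do rewrite mxE.
rewrite exchange_big/= /qform [RHS]exchange_big; apply: eq_bigr => i _.
rewrite [RHS]exchange_big; apply: eq_bigr => j _.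
rewrite mxE mulr_suml; apply: eq_bigr => k _.
by rewrite !mxE; ring.
Qed.

End Vectors.
End FrobeniusNorm.

(** * Optimality conditions in space and growth of the weight *)

Section SpatialMaximum.
Variables (R : realType) (d : nat).
Local Notation E := 'cV[R]_d.
Implicit Types (u w v : R -> E -> R) (t : R) (x y p q : E).

Lemma cV_sum_delta p : p = \sum_i p i 0 *: delta_mx i 0.
Proof.
rewrite [LHS]matrix_sum_delta; apply: eq_bigr => i _.
by rewrite big_ord1.
Qed.

Lemma strip_open_slice T (g : R -> E -> R) t :
  {within strip_open T, continuous (fun p : R * E => g p.1 p.2)} ->
  0 <= t < T -> continuous (g t).
Proof.
move=> /subspace_continuousP gc tT x.
have /= gx := gc (t, x) tT.
have Fx : (fun y => (t, y)) @ nbhs x --> within (strip_open T) (nbhs (t, x)).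
  move=> A /= [[B C] [/= Bt Cx] BCA].
  by apply: filterS Cx => y Cy; apply: BCA => //; split=> //; exact: nbhs_singleton.
exact: cvg_comp Fx gx.
Qed.

Lemma is_derive_dir (g : E -> R) (D : 'I_d -> E -> R) :
  (forall i x, is_derive x (delta_mx i 0) g (D i x)) ->
  (forall i, continuous (D i)) ->
  forall x p, is_derive x p g (\sum_i p i 0 * D i x).
Proof.
move=> gD Dc x p; rewrite [X in is_derive x X]cV_sum_delta.
by apply: is_derive_sumv => // i; exact: Dc.
Qed.

(** [is_derive_dir] is used twice: on [u t], along the whole line, and on each partial derivative,
    at the base point. The continuity in space that it asks for is obtained by slicing the joint
    continuity at time [t]. *)
Lemma jet2_C12 T u t x p : C12 T u -> 0 <= t < T ->
  jet2 (fun s => u t (x + s *: p)) (u t x) (dotv (grad u t x) p)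
    (qform (hess u t x) p).
Proof.
move=> uC tT; split; first by rewrite scale0r addr0.
have D1 : forall y q, is_derive y q (u t) (\sum_i q i 0 * dx u i t y).
  apply: (@is_derive_dir (u t) (fun i => dx u i t)) => [i y|i].
    by apply/derivableP; exact: (C12_dx uC).
  exact: (@strip_open_slice T (dx u i) t (@C12_dx_cont _ _ _ _ uC i) tT).
have D2 : forall j y q, is_derive y q (dx u j t) (\sum_i q i 0 * dxx u i j t y).
  move=> j; apply: (@is_derive_dir (dx u j t) (fun i => dxx u i j t)) => [i y|i].
    by apply/derivableP; exact: (C12_dxx uC).
  exact: (@strip_open_slice T (dxx u i j) t (@C12_dxx_cont _ _ _ _ uC i j) tT).
exists (fun s => \sum_i p i 0 * dx u i t (x + s *: p)); split.
- by move=> s; apply: is_derive_line.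
- rewrite scale0r addr0; apply: eq_bigr => i _; by rewrite mxE mulrC.
- have H i : is_derive (0 : R) 1 (p i 0 *: (fun s => dx u i t (x + s *: p)))
      (p i 0 *: \sum_j p j 0 * dxx u j i t x).
    apply: is_deriveZ; apply: is_derive_line; rewrite scale0r addr0; exact: D2.
  have := is_derive_sum H.
  rewrite (_ : \sum_i _ = fun s : R => \sum_i p i 0 * dx u i t (x + s *: p));
    last first.
    by apply/funext => s; rewrite fct_sumE.
  move=> K; apply: (is_derive_eq K).
  rewrite /qform exchange_big; apply: eq_bigr => j _.
  rewrite [LHS]mulr_sumr; apply: eq_bigr => i _.
  by rewrite mxE mulrCA mulrA.
Qed.

Lemma jet2_sqnorm x p : jet2 (fun s => dotv (x + s *: p) (x + s *: p))
  (dotv x x) (2 * dotv x p) (2 * dotv p p).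
Proof.
have A := jet2_affine (0 : R) 1.
have := jet2D (jet2D (jet2_cst (dotv x x)) (jet2Z (2 * dotv x p) A))
  (jet2Z (dotv p p) (jet2M A A)).
rewrite (_ : (fun s => _) = fun s => dotv (x + s *: p) (x + s *: p)).
  by move=> /jet2_eq; apply; ring.
apply/funext => s; rewrite dotvDl !dotvDr !dotvZl !dotvZr (dotvC p x).
by ring.
Qed.

Variable k : nat.

Definition sq1 x : R := 1 + dotv x x.

(** The offset 2 keeps the exponents of the derivatives free of subtraction, and makes [chi] grow
    strictly faster than [sq1 ^+ k], the growth that it will have to dominate. *)
Definition chi x : R := sq1 x ^+ k.+2.

Definition grad_chi x : E := (k.+2%:R * sq1 x ^+ k.+1 * 2) *: x.

Definition hess_chi x p : R := k.+2%:R *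
  (k.+1%:R * sq1 x ^+ k * (2 * dotv x p) ^+ 2 + sq1 x ^+ k.+1 * (2 * dotv p p)).

Lemma jet2_chi x p : jet2 (fun s => chi (x + s *: p)) (chi x)
  (dotv (grad_chi x) p) (hess_chi x p).
Proof.
have := jet2X k (jet2D (jet2_cst 1) (jet2_sqnorm x p)).
move=> /jet2_eq; apply=> //; rewrite ?dotvZl /hess_chi /sq1 ?add0r//.
by ring.
Qed.

Lemma sq1_ge1 x : 1 <= sq1 x.
Proof. by rewrite lerDl dotvv_ge0. Qed.

(** One constant for three estimates under linear growth with constant [C]: the gradient of [chi]
    along the drift and along the columns of the diffusion costs 4(k+2)C, half of its second-order
    term (k+2)(4(k+1)+2)C^2. Since all are multiples of [chi] itself, the exponential factor in time
    can absorb them. *)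
Definition growth_cst (C : R) := k.+2%:R * (8 * k.+1%:R + 2) * (C + C ^+ 2).

Section Growth.
Variables (C : R) (x : E).
Hypothesis C0 : 0 <= C.

Let S0 n : 0 <= sq1 x ^+ n.
Proof. by rewrite exprn_ge0// (le_trans ler01 (sq1_ge1 x)). Qed.

Let growth1 : k.+2%:R * 4 * C <= growth_cst C.
Proof.
rewrite /growth_cst -2!mulrA ler_wpM2l// ler_pM ?mulr_ge0//.
- rewrite -natr1; have : 0 <= (k%:R : R) by []. lra.
- by rewrite lerDl sqr_ge0.
Qed.

Lemma grad_chi_le p : frob p <= C * (1 + frob x) ->
  `|dotv (grad_chi x) p| <= growth_cst C * chi x.
Proof.
move=> pC; rewrite dotvZl normrM ger0_norm ?mulr_ge0//.
apply: (@le_trans _ _ (k.+2%:R * sq1 x ^+ k.+1 * 2 * (2 * C * sq1 x))).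
  rewrite ler_wpM2l ?mulr_ge0//; apply: (le_trans (ler_dotv _ _)).
  have x0 := frob_ge0 x.
  apply: (le_trans (ler_wpM2l x0 pC)).
  rewrite /sq1 dotvv; have := mulr_ge0 C0 (sqr_ge0 (frob x - 1)); have :=
    mulr_ge0 C0 x0; nra.
rewrite /chi (exprSr _ k.+1) -subr_ge0 (_ : _ - _ = (growth_cst C - k.+2%:R * 4 *
  C) * (sq1 x ^+ k.+1 * sq1 x)); last by ring.
by rewrite mulr_ge0 ?subr_ge0// -exprSr.
Qed.

Lemma mulTmx_grad_chi_le (s : 'M[R]_d) : frob s <= C * (1 + frob x) ->
  frob (s^T *m grad_chi x) <= growth_cst C * chi x.
Proof.
move=> sC; apply: (le_trans (frob_mulTmx _ _)).
rewrite frobZ ger0_norm ?mulr_ge0//.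
rewrite mulrCA; apply: (@le_trans _ _ (k.+2%:R * sq1 x ^+ k.+1 * 2 * (2 * C * sq1 x))).
  rewrite ler_wpM2l ?mulr_ge0//.
  have x0 := frob_ge0 x.
  apply: (le_trans (ler_wpM2r x0 sC)).
  rewrite /sq1 dotvv; have := mulr_ge0 C0 (sqr_ge0 (frob x - 1)); have :=
    mulr_ge0 C0 x0; nra.
rewrite /chi (exprSr _ k.+1) -subr_ge0 (_ : _ - _ = (growth_cst C - k.+2%:R * 4 *
  C) * (sq1 x ^+ k.+1 * sq1 x)); last by ring.
by rewrite mulr_ge0 ?subr_ge0// -exprSr.
Qed.

Lemma hess_chi_le (s : 'M[R]_d) : frob s <= C * (1 + frob x) ->
  \sum_j hess_chi x (col j s) <= 2 * (growth_cst C * chi x).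
Proof.
move=> sC; rewrite /hess_chi -mulr_sumr big_split/=.
under eq_bigr do rewrite exprMn mulrA.
rewrite -mulr_sumr sum_dotv_col; under [X in _ * (_ + X)]eq_bigr do rewrite mulrA.
rewrite -mulr_sumr sum_dotvv_col.
have x0 := frob_ge0 x; have s0 := frob_ge0 s.
have s2 : frob s ^+ 2 <= 2 * C ^+ 2 * sq1 x.
  apply: (@le_trans _ _ ((C * (1 + frob x)) ^+ 2)).
    by rewrite ler_sqr ?nnegrE ?mulr_ge0 ?addr_ge0.
  rewrite exprMn /sq1 dotvv; have := mulr_ge0 (sqr_ge0 C) (sqr_ge0 (frob x - 1)); nra.
have sx : frob (s^T *m x) ^+ 2 <= 2 * C ^+ 2 * sq1 x * sq1 x.
  apply: (@le_trans _ _ (frob s ^+ 2 * frob x ^+ 2)).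
    by rewrite -exprMn ler_sqr ?nnegrE ?mulr_ge0 ?frob_ge0//; exact: frob_mulTmx.
  rewrite ler_pM ?sqr_ge0//; rewrite /sq1 dotvv; lra.
rewrite /growth_cst /chi !(exprSr (sq1 x)).
set S := sq1 x in s2 sx *.
have Sk : 0 <= S ^+ k := S0 k.
have S1 : 1 <= S := sq1_ge1 x.
have k0 : (0 : R) <= k%:R by [].
have A : k.+1%:R * S ^+ k * 2 ^+ 2 * frob (s^T *m x) ^+ 2
    <= k.+1%:R * S ^+ k * 2 ^+ 2 * (2 * C ^+ 2 * S * S).
  by rewrite ler_wpM2l// !mulr_ge0.
have B : S ^+ k * S * 2 * frob s ^+ 2 <= S ^+ k * S * 2 * (2 * C ^+ 2 * S).
  by rewrite ler_wpM2l// !mulr_ge0//; lra.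
rewrite [leRHS](_ : _ = k.+2%:R * (2 * (8 * k.+1%:R + 2) * (C + C ^+ 2) * (S ^+ k
  * S * S))); last by ring.
rewrite ler_wpM2l//.
have SS : 0 <= S ^+ k * S * S by rewrite !mulr_ge0//; lra.
have CS : 0 <= C * (S ^+ k * S * S) by rewrite mulr_ge0.
apply: (le_trans (lerD A B)).
rewrite -subr_ge0.
rewrite (_ : _ - _ = 8 * k.+1%:R * (C ^+ 2 * (S ^+ k * S * S)) + 2 * (8 * k.+1%:R
  + 2) * (C * (S ^+ k * S * S))); last by ring.
have CSS : 0 <= C ^+ 2 * (S ^+ k * S * S) by rewrite mulr_ge0// sqr_ge0.
have k1 : 0 <= 8 * k.+1%:R :> R by rewrite mulr_ge0.
by rewrite addr_ge0// mulr_ge0// mulr_ge0// addr_ge0.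
Qed.

End Growth.

(** Differentiating -v + gam (v-A)^2 gives -al v' at first order and -al v'' + 2 gam v'^2 at second
    order, which is the origin of [al] and of the square with a favourable sign. Where |v| <= A one
    has al >= 1, so the supersolution inequality may be multiplied by [al]. *)
Lemma doubled_jet_max (fw fv fq fx fy : R -> R) (cw aw bw cv av bv cq aq bq
    cx ax bx cy ay by' a e gam A del : R) :
  jet2 fw cw aw bw -> jet2 fv cv av bv -> jet2 fq cq (2 * aq) (2 * bq) ->
  jet2 fx cx ax bx -> jet2 fy cy ay by' ->
  (forall s, a * (fw s - fv s + gam * (fv s - A) ^+ 2 - (2 * e)^-1 * fq s)
      - del * (fx s + fy s)
    <= a * (cw - cv + gam * (cv - A) ^+ 2 - (2 * e)^-1 * cq) - del * (cx + cy)) ->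
  let al := 1 - 2 * gam * (cv - A) in
  a * (aw - al * av - e^-1 * aq) = del * (ax + ay) /\
  a * (bw - al * bv + 2 * gam * av ^+ 2 - e^-1 * bq) <= del * (bx + by').
Proof.
move=> Jw Jv Jq Jx Jy xymax al.
have JvA := jet2B Jv (jet2_cst A).
have J := jet2B (jet2Z a (jet2B (jet2D (jet2B Jw Jv) (jet2Z gam (jet2M JvA JvA)))
  (jet2Z (2 * e)^-1 Jq))) (jet2Z del (jet2D Jx Jy)).
have [|D1 D2] := jet2_max J.
  move=> s; have := xymax s.
  by rewrite (proj1 Jw) (proj1 Jv) (proj1 Jq) (proj1 Jx) (proj1 Jy) !expr2.
have E2 z : (2 * e)^-1 * (2 * z) = e^-1 * z.
  by rewrite mulrA; congr (_ * _); rewrite invfM mulrAC mulVf ?mul1r.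
move: D1 D2; rewrite !E2 /al => D1 D2; split.
  by apply/eqP; rewrite -subr_eq0; apply/eqP; rewrite -[RHS]D1; ring.
rewrite -subr_le0; apply: le_trans D2; rewrite le_eqVlt; apply/orP; left.
by apply/eqP; ring.
Qed.

(* [p] and [q] will run through the columns of [s1 t x] and [s2 t y]: summing
   the second-order condition over the columns produces both traces, which is
   the synchronous coupling of the two diffusions. *)
Lemma spatial_max_conditions T w v t x y (a del gam A eps : R) :
  C12 T w -> C12 T v -> 0 <= t < T ->
  (forall x' y', a * (w t x' - v t y' + gam * (v t y' - A) ^+ 2
        - (2 * eps)^-1 * dotv (x' - y') (x' - y')) - del * (chi x' + chi y')
     <= a * (w t x - v t y + gam * (v t y - A) ^+ 2
        - (2 * eps)^-1 * dotv (x - y) (x - y)) - del * (chi x + chi y)) ->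
  let al := 1 - 2 * gam * (v t y - A) in
  forall p q,
  a * (dotv (grad w t x) p - al * dotv (grad v t y) q
      - eps^-1 * dotv (x - y) (p - q))
    = del * (dotv (grad_chi x) p + dotv (grad_chi y) q) /\
  a * (qform (hess w t x) p - al * qform (hess v t y) q
      + 2 * gam * dotv (grad v t y) q ^+ 2 - eps^-1 * dotv (p - q) (p - q))
    <= del * (hess_chi x p + hess_chi y q).
Proof.
move=> wC vC tT xymax al p q.
have Jw := jet2_C12 x p wC tT; have Jv := jet2_C12 y q vC tT.
apply: (doubled_jet_max Jw Jv (jet2_sqnorm (x - y) (p - q)) (jet2_chi x p)
  (jet2_chi y q)) => s.
by rewrite -(_ : x + s *: p - (y + s *: q) = x - y + s *: (p - q)) ?xymax//
  scalerBr opprD addrACA.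
Qed.

End SpatialMaximum.

(** * Measurability in time at a fixed space point *)

Section BorelSections.
Variable R : realType.

(** All three maps are measured with the sigma-algebras generated by open sets: [path] and [psi] are
    continuous, and closedness of [D] makes [D] measurable, as composing with [g] requires. *)
Lemma borel_section (X Y : normedModType R) (D : set X) (g : X -> Y)
    (path : R -> X) (psi : Y -> R) (J : set R) :
  measurable J -> closed D -> borel_fun D g -> continuous path -> continuous psi ->
  (forall t, J t -> D (path t)) -> measurable_fun J (fun t => psi (g (path t))).
Proof.
move=> mJ Dc gD pc psic JD.
pose X' := g_sigma_algebraType (@open X); pose Y' := g_sigma_algebraType (@open Y).
have mpath : measurable_fun J (path : R -> X').
  apply: (@measurability _ _ R X' J path (@open X)) => // _ [U oU <-].
  by apply: measurableI => //; apply: open_measurable; move/continuousP: pc; apply.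
have mpsi : measurable_fun setT (psi : Y' -> R).
  apply: (measurability _ (RGenOpens.measurableE R)) => _ [_ [a [b ->]] <-].
  rewrite setTI; apply: sub_sigma_algebra.
  by move/continuousP: psic; apply; exact: interval_open.
have mD : measurable (D : set X').
  rewrite -(setCK D); apply: measurableC; apply: sub_sigma_algebra.
  exact: closed_openC.
have mgp : measurable_fun J ((g : X' -> Y') \o path).
  apply: (@measurable_comp _ _ _ R X' Y' D) => //.
  by move=> _ [t Jt <-]; exact: JD.
by apply: (@measurable_comp _ _ _ R Y' R setT psi J (g \o path)).
Qed.

End BorelSections.

(** * Uniform convergence outside a small open set of times *)

Section UniformOutsideSmallOpen.
Variable R : realType.
Local Notation mu := (@lebesgue_measure R).

Lemma compact_finite_net (V : normedModType R) (K : set V) (e : R) :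
  compact K -> 0 < e -> exists s : seq V, (forall q, q \in s -> K q) /\
    forall p, K p -> exists2 q, q \in s & `|p - q| < e.
Proof.
move=> cK e0; move: cK; rewrite compact_cover => /(_ V K (fun q => ball q e)) [].
- by move=> q _; exact: ball_open.
- by move=> p Kp; exists p => //; exact: ballxx.
move=> D DK KD; exists (finmap.enum_fset D); split.
  by move=> q qD; apply/set_mem/DK.
move=> p /KD[q /= qD]; rewrite -ball_normE /= => qp.
by exists q => //; rewrite distrC.
Qed.

(** Egorov's theorem is applied once, to the sum [G] of |g| over a finite net of [K], with half of
    [eta]; the other half pays for enlarging the exceptional set to an open one by outer regularity.
    Equicontinuity, uniform in time and index, carries the bound from the net to all of [K]. *)
Lemma small_open_uniform (T : R) (V : normedModType R) (K : set V)
    (g : nat -> R -> V -> R) (zeta eta : R) :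
  compact K ->
  (forall n p, K p -> measurable_fun `[0, T] (fun t => g n t p)) ->
  (forall e, 0 < e -> exists2 delta, 0 < delta & forall n t p q,
    0 <= t <= T -> K p -> K q -> `|p - q| < delta -> `|g n t p - g n t q| < e) ->
  (forall t p, 0 <= t <= T -> K p -> g n t p @[n --> \oo] --> (0 : R)) ->
  0 < zeta -> 0 < eta ->
  exists O : set R, [/\ open O, (mu O < eta%:E)%E &
    \forall n \near \oo, forall t p, 0 <= t <= T -> ~ O t -> K p ->
      `|g n t p| <= zeta].
Proof.
move=> cK mg equi g0 zeta0 eta0.
have zeta2 : 0 < zeta / 2 by rewrite divr_gt0.
have eta2 : 0 < eta / 2 by rewrite divr_gt0.
have [delta delta0 deltaP] := equi _ zeta2.
have [s [sK sP]] := compact_finite_net cK delta0.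
pose G n t := \sum_(q <- s) `|g n t q|.
have [|||||B [mB Beta Bunif]] := @pointwise_almost_uniform _ R _ mu G (cst 0)
  `[0, T] (eta / 2).
(* The sum over a list is rewritten over its indices for the sake of measurability; the default 0 of
   [nth] is never reached. *)
- move=> n; apply: (eq_measurable_fun (fun t => \sum_(i < size s) `|g n t (nth 0
  s i)|)).
    by move=> t _; rewrite /G (big_nth 0) big_mkord.
  apply: measurable_sum => i; apply: measurableT_comp => //; apply: mg; apply: sK.
  exact: mem_nth.
- exact: measurable_itv.
- by rewrite /= lebesgue_measure_itv/=; case: ifP => _; rewrite ?ltry// -EFinD ltry.
- move=> t; rewrite /= in_itv/= => tT.
  suff : G n t @[n --> \oo] --> \sum_(q <- s) (0 : R) by rewrite big1.
  rewrite /G; elim: (s) sK => [_|q r IHr rK].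
    by under eq_fun do rewrite big_nil; rewrite big_nil; exact: cvg_cst.
  under eq_fun do rewrite big_cons; rewrite big_cons.
  apply: cvgD; last by apply: IHr => p pr; apply: rK; rewrite in_cons pr orbT.
  rewrite -(@normr0 _ R); apply: cvg_norm; apply: g0 => //.
  by apply: rK; rewrite mem_head.
- exact: eta2.
have Bfin : (mu B < +oo)%E by apply: (lt_trans Beta); exact: ltry.
have [U [oU BU Ueta]] := lebesgue_regularity_outer mB Bfin eta2.
exists U; split => //.
  have mU : measurable U by exact: open_measurable.
  rewrite -(setDUK BU) measureU//; last by rewrite setDIK.
    by rewrite [eta]splitr EFinD lteD.
  exact: measurableD.
have near0 : nbhs ((cst 0 : R -> R) : {uniform` `[0, T] `\` B -> R})
    [set h | forall t, (`[0, T] `\` B) t -> `|h t| < zeta / 2].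
  apply/uniform_nbhs; exists [set xy | `|xy.1 - xy.2| < zeta / 2]; split.
    by rewrite -entourage_from_ballE; exists (zeta / 2).
  by move=> h /= hP t tB; have := hP t tB; rewrite sub0r normrN.
have /= := Bunif _ near0; apply: filterS => n nP t p tT nUt Kp.
have tB : (`[0, T] `\` B) t by split; [rewrite /= in_itv|move=> /BU].
have [q qs pq] := sP p Kp.
have gq : `|g n t q| <= G n t by rewrite /G (big_rem q)//= lerDl sumr_ge0.
rewrite -(subrK (g n t q) (g n t p)) (le_trans (ler_normD _ _))// [zeta]splitr lerD//.
  by apply/ltW; apply: deltaP => //; exact: sK.
apply: (le_trans gq); rewrite -[leLHS]ger0_norm ?sumr_ge0//; apply/ltW; exact: nP.
Qed.

(* Openness of [O] gives [F] slope exactly -1 at every point of [O], so [F]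
   penalizes [O] pointwise although its total variation is small. *)
Lemma open_tail_measure (O : set R) (eta : R) : open O -> (mu O < eta%:E)%E ->
  exists F : R -> R, [/\ forall t, 0 <= F t <= eta,
    forall t s, t <= s -> F s <= F t <= F s + (s - t) &
    forall t, O t -> \forall s \near t^'+, F t = F s + (s - t)].
Proof.
move=> oO Oeta; have mO : measurable O by exact: open_measurable.
pose M t := O `&` `[t, +oo[%classic.
have mM t : measurable (M t) by apply: measurableI => //; exact: measurable_itv.
have Mle t : (mu (M t) <= mu O)%E by apply: (le_measure mu); rewrite ?inE;
  [exact: mM|exact: mO|move=> z []].
have Mfin t : mu (M t) \is a fin_num.
  rewrite ge0_fin_numE//; apply: (le_lt_trans (Mle t)); apply: (lt_trans Oeta).
  exact: ltry.
pose N t s := O `&` `[t, s[%classic.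
have mN t s : measurable (N t s) by apply: measurableI => //; exact: measurable_itv.
have MN t s : t <= s -> mu (M t) = (mu (N t s) + mu (M s))%E.
  move=> ts; have -> : M t = N t s `|` M s.
    rewrite /M /N -setIUr; congr (_ `&` _).
    apply/seteqP; split=> z /=; rewrite !in_itv/= !andbT.
      by move=> tz; have [zs|sz] := ltP z s; [left; rewrite tz|right].
    by case=> [/andP[]//|sz]; exact: le_trans sz.
  apply: measureU; [exact: mN|exact: mM|].
  rewrite /N /M -setIIr (_ : _ `&` `[s, +oo[ = set0) ?setI0//.
  apply/seteqP; split=> // z [] /=; rewrite !in_itv/= andbT => /andP[_ zs] sz.
  by move: (lt_le_trans zs sz); rewrite ltxx.
have itvE t s : t <= s -> mu `[t, s[%classic = (s - t)%:E.
  move=> ts; rewrite lebesgue_measure_itv/= lte_fin; case: ltP => // st.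
  by rewrite (@le_anti _ _ t s) ?subrr// ts st.
have Nle t s : t <= s -> (mu (N t s) <= (s - t)%:E)%E.
  move=> ts; rewrite -(itvE _ _ ts); by apply: (le_measure mu); rewrite ?inE;
    [exact: mN|exact: measurable_itv|move=> z []].
exists (fun t => fine (mu (M t))); split=> [t|t s ts|t Ot].
- rewrite fine_ge0//= -lee_fin fineK//; exact: le_trans (Mle t) (ltW Oeta).
- rewrite -!lee_fin EFinD !fineK// (MN _ _ ts) leeDr//= addeC leeD2l//.
  exact: Nle.
have : \forall s \near t^'+, `[t, s[%classic `<=` O.
  have /nbhs_ballP[e /= e0 eO] : nbhs t O by exact: open_nbhs_nbhs.
  near=> s; move=> z /=; rewrite in_itv/= => /andP[tz zs]; apply: eO.
  rewrite -ball_normE /= distrC ger0_norm ?subr_ge0//.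
  rewrite ltrBlDl; apply: (lt_trans zs); near: s; apply: nbhs_right_lt.
  by rewrite ltrDl.
apply: filterS2 (nbhs_right_ge t) => s ts tsO.
have -> : mu (M t) = (mu (M s) + (s - t)%:E)%E.
  by rewrite (MN _ _ ts) addeC /N setIC setIidl// itvE.
by rewrite fineD.
Unshelve. all: by end_near. Qed.

End UniformOutsideSmallOpen.

(** * Linear growth deduced from the Lipschitz conditions *)

Section LipschitzCoefficients.
Variables (R : realType) (d : nat) (T C : R).
Local Notation E := 'cV[R]_d.
Variables (b : R -> E -> E) (s : R -> E -> 'M[R]_d) (f : R -> E -> R -> E -> R).
Hypothesis lipC : lipschitz_coefs T C b s f.
Variable t : R.
Hypothesis tT : 0 <= t <= T.

Lemma lip_b x x' : frob (b t x - b t x') <= C * frob (x - x').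
Proof. by apply: le_trans (lip_b_sigma lipC x x' tT); rewrite lerDl frob_ge0. Qed.

Lemma lip_sigma x x' : frob (s t x - s t x') <= C * frob (x - x').
Proof. by apply: le_trans (lip_b_sigma lipC x x' tT); rewrite lerDr frob_ge0. Qed.

Lemma growth_b x : frob (b t x) <= C * (1 + frob x).
Proof.
rewrite -(subrK (b t 0) (b t x)) (le_trans (frobD _ _))// mulrDr mulr1 addrC lerD//.
  by apply: le_trans (bound_b_sigma lipC tT); rewrite lerDl frob_ge0.
by rewrite -[in leRHS](subr0 x); exact: lip_b.
Qed.

Lemma growth_sigma x : frob (s t x) <= C * (1 + frob x).
Proof.
rewrite -(subrK (s t 0) (s t x)) (le_trans (frobD _ _))// mulrDr mulr1 addrC lerD//.
  by apply: le_trans (bound_b_sigma lipC tT); rewrite lerDr frob_ge0.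
by rewrite -[in leRHS](subr0 x); exact: lip_sigma.
Qed.

Lemma growth_f x y z : `|f t x y z| <= `|f t x y 0| + C * frob z.
Proof.
have := lip_f lipC x y y z 0 tT; rewrite subrr normr0 add0r subr0.
by have := ler_normD (f t x y z - f t x y 0) (f t x y 0); rewrite subrK; lra.
Qed.

End LipschitzCoefficients.

(** * The inequality at an interior maximum of the doubled function *)

(** Here [a] is the exponential factor, [B] the bracket it multiplies, [X] the weight term, [r2] =
    |x-y|^2 / eps, [ie] = 1/eps and [Z] the norm of sigma^T Dv. [F1], [F1'], [F2] are the first
    generator at (w, z1), the same at (v, z2), and the second generator at (v, z2). The bound on
    [mu] is dictated by what must be absorbed: [C * B] from the Lipschitz dependence on the
    solution, and [Cg * X] once from the drift, once from half the trace and [C] times from the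
    gradient variable. *)
Lemma doubling_arith (R : realType) (a al mu B X C Cg wt vt bw bv q1 q2 F1 F2 F1'
    dwv dz Z r2 ie D eta gam A Kf G : R) :
  0 <= a -> 0 <= al -> 0 <= C -> 0 <= Cg -> 1 <= ie -> 0 <= D -> 0 <= gam ->
  0 <= B ->
  0 <= wt + bw + 2^-1 * q1 + F1 -> vt + bv + 2^-1 * q2 + F2 <= 0 ->
  a * (wt - al * vt + mu * B) <= - G ->
  a * (bw - al * bv) <= a * (C * r2 + D * ie) + Cg * X ->
  a * (q1 - al * q2) <= 2 * (Cg * X) + a * (2 * C ^+ 2 * r2 + 2 * (ie * D ^+ 2))
    - 2 * a * gam * Z ^+ 2 ->
  F1 - F1' <= C * (dwv + dz) -> F1' - F2 <= eta + D + 2^-1 * (gam * Z ^+ 2) ->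
  (1 - al) * F2 <= 4 * gam * A * (Kf + C * Z) ->
  a * dz <= a * (C * r2 + D * ie) + Cg * X + a * (4 * gam * A * Z) ->
  dwv <= B + 2^-1 * r2 + 4 * gam * A ^+ 2 ->
  X <= a * B -> C + (2 + C) * Cg <= mu ->
  G <= a * ((3 / 2 * C + 2 * C ^+ 2) * r2 + ie * ((2 + C) * D + D ^+ 2) + eta
    + gam * (4 * C * A ^+ 2 + 4 * A * Kf + 32 * A ^+ 2 * C ^+ 2)).
Proof.
move=> a0 al0 C0 Cg0 ie1 D0 gam0 B0 H1 H2 Ht Hb Hq HF1 HF2 HF3 Hdz Hdwv HX Hmu.
have p1 := mulr_ge0 a0 H1.
have p2 := mulr_ge0_le0 a0 (mulr_ge0_le0 al0 H2).
have p3 := ler_wpM2l a0 HF1.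
have p4 := ler_wpM2l C0 (ler_wpM2l a0 Hdwv).
have p5 := ler_wpM2l C0 Hdz.
have p6 := ler_wpM2l a0 HF2.
have p7 := ler_wpM2l a0 HF3.
have p8 := ler_wpM2r (mulr_ge0 a0 B0) Hmu.
have p9 : (2 + C) * Cg * X <= (2 + C) * Cg * (a * B).
  by apply: ler_wpM2l => //; apply: mulr_ge0 => //; apply: addr_ge0.
(* The trace provides -gam Z^2, of which half is spent on the generators. The other half pays for
   the cross terms 8 gam A C Z, leaving the constant 32 gam A^2 C^2. *)
have p10 := mulr_ge0 (mulr_ge0 a0 gam0) (sqr_ge0 (Z - 8 * C * A)).
have p11 := ler_wpM2l (mulr_ge0 a0 D0) ie1.
clear - Ht Hb Hq p1 p2 p3 p4 p5 p6 p7 p8 p9 p10 p11.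
lra.
Qed.


Lemma trace_arith (R : realType) (a al gam ie q1 q2 Z S h1 h2 del gx gy CgX K : R) :
  a * (q1 - al * q2 + 2 * gam * Z - ie * S) <= del * (h1 + h2) ->
  del * h1 + del * h2 <= del * (2 * gx) + del * (2 * gy) ->
  del * gx + del * gy = CgX -> a * (ie * S) <= a * K ->
  a * (q1 - al * q2) <= 2 * CgX + a * K - 2 * a * gam * Z.
Proof. by move=> *; lra. Qed.

(* [f] is only locally equicontinuous in [x], so for gradients beyond [N] the
   difference of the generators is paid by the [gam * Z ^+ 2] that the term
   [gam * (v - A) ^+ 2] of the doubled function creates. *)
Lemma large_gradient_arith (R : realType) (F1 F2 F01 F02 C Z Kf gam N eta D : R) :
  0 <= gam -> 0 <= eta -> 0 <= D -> 0 <= Z -> 0 <= Kf -> 0 <= C ->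
  `|F1| <= `|F01| + C * Z -> `|F2| <= `|F02| + C * Z ->
  `|F01| <= Kf -> `|F02| <= Kf -> 4 * (Kf + C) <= gam * N -> 1 <= N -> N <= Z ->
  F1 - F2 <= eta + D + 2^-1 * (gam * Z ^+ 2).
Proof.
move=> gam0 eta0 D0 Z0 Kf0 C0 F1le F2le K1 K2 HN N1 NZ.
have n1 := ler_norm F1; have n2 := ler_norm (- F2); rewrite normrN in n2.
have e1 := ler_wpM2l Kf0 (le_trans N1 NZ).
have e2 := ler_wpM2r Z0 HN.
have e3 := ler_wpM2l (mulr_ge0 gam0 Z0) NZ.
have gZ := mulr_ge0 gam0 (sqr_ge0 Z).
clear - n1 n2 e1 e2 e3 gZ F1le F2le K1 K2 D0 eta0; lra.
Qed.

(** The generator is Lipschitz but not monotone in the solution, so W - V is needed in absolute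
    value. Since (V-A)^2 <= 4 A^2, the lower side costs only a term of order [gam]. *)
Lemma value_gap_arith (R : realType) (W V B r gam A : R) :
  `|V| <= A -> 0 <= gam -> 0 <= r -> 0 <= B ->
  B = W - V + gam * (V - A) ^+ 2 - 2^-1 * r ->
  `|W - V| <= B + 2^-1 * r + 4 * gam * A ^+ 2.
Proof.
rewrite ler_norml => /andP[V1 V2] gam0 r0 B0 BE.
have A0 : 0 <= A by lra.
have e1 : 0 <= gam * (V - A) ^+ 2 by rewrite mulr_ge0// sqr_ge0.
have e2 : gam * (V - A) ^+ 2 <= gam * (4 * A ^+ 2).
  rewrite ler_wpM2l//; have := mulr_ge0 (_ : 0 <= V + A) (_ : 0 <= 3 * A - V);
    rewrite !subr_ge0; nra.
rewrite ler_norml; apply/andP; split; lra.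
Qed.

Lemma quadratic_sum_le (R : realType) (I : finType) (F1 F2 F3 F4 H1 H2 : I -> R)
    (a al c e del s1 s2 s3 s4 : R) :
  s1 = \sum_j F1 j -> s2 = \sum_j F2 j -> s3 = \sum_j F3 j -> s4 = \sum_j F4 j ->
  (forall j, a * (F1 j - al * F2 j + c * F3 j - e * F4 j) <= del * (H1 j + H2 j)) ->
  a * (s1 - al * s2 + c * s3 - e * s4) <= del * (\sum_j H1 j + \sum_j H2 j).
Proof.
move=> -> -> -> -> H; rewrite -big_split/= [al * _]mulr_sumr [c * _]mulr_sumr.
rewrite [e * _]mulr_sumr -sumrB -big_split -sumrB/= !mulr_sumr.
by apply: ler_sum => j _; exact: H.
Qed.

Section DoublingInequality.
Variables (R : realType) (d : nat) (T C : R).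
Local Notation E := 'cV[R]_d.
Variables (b1 b2 : R -> E -> E) (s1 s2 : R -> E -> 'M[R]_d).
Variables (f1 f2 : R -> E -> R -> E -> R).
Hypothesis C0 : 0 <= C.
Hypothesis lip1 : lipschitz_coefs T C b1 s1 f1.
Hypothesis lip2 : lipschitz_coefs T C b2 s2 f2.
Variables (w v : R -> E -> R).
Hypothesis wC : C12 T w.
Hypothesis vC : C12 T v.
Variables (k : nat) (t : R) (x y : E).
Hypothesis tT : 0 <= t < T.
Variables (a del gam A eps Kf N D eta mu G : R).
Let B := w t x - v t y + gam * (v t y - A) ^+ 2
  - (2 * eps)^-1 * dotv (x - y) (x - y).
Let al := 1 - 2 * gam * (v t y - A).
Let Cg := growth_cst k C.

(** No derivative of [w] or [v] survives in the conclusion. The coefficient gap [D] appears with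
    1/eps because, up to the weight, the gradients are coupled through (x-y)/eps; the remaining
    errors are the Lipschitz cost of |x-y|^2 / eps, the tolerance [eta] and terms proportional to
    [gam]. *)
Lemma doubling_inequality :
  1 <= a -> 0 <= del -> 0 < gam -> 0 < eps <= 1 -> 0 <= A -> 0 <= Kf -> 0 <= D ->
  0 <= eta ->
  0 <= parabolic_op T b1 s1 f1 w t x ->
  parabolic_op T b2 s2 f2 v t y <= 0 ->
  (forall x' y', a * (w t x' - v t y' + gam * (v t y' - A) ^+ 2
        - (2 * eps)^-1 * dotv (x' - y') (x' - y')) - del * (chi k x' + chi k y')
     <= a * B - del * (chi k x + chi k y)) ->
  a * (dt T w t x - al * dt T v t y + mu * B) <= - G ->
  del * (chi k x + chi k y) <= a * B ->
  C + (2 + C) * Cg <= mu ->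
  `|v t y| <= A -> `|f1 t x (v t y) 0| <= Kf -> `|f2 t y (v t y) 0| <= Kf ->
  4 * (Kf + C) <= gam * N -> 1 <= N ->
  frob (b1 t y - b2 t y) <= D -> frob (s1 t y - s2 t y) <= D ->
  (forall z, frob z <= N -> f1 t x (v t y) z - f2 t y (v t y) z <= eta + D) ->
  frob (x - y) <= 1 ->
  G <= a * ((3 / 2 * C + 2 * C ^+ 2) * (eps^-1 * frob (x - y) ^+ 2)
    + eps^-1 * ((2 + C) * D + D ^+ 2) + eta
    + gam * (4 * C * A ^+ 2 + 4 * A * Kf + 32 * A ^+ 2 * C ^+ 2)).
Proof.
move=> a1 del0 gam0 /andP[eps0 eps1] A0 Kf0 D0 eta0 Hw Hv xymax Ht HX Hmu vA Hf1
  Hf2 HN N1 HDb HDs HDf xy1.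
have tT' : 0 <= t <= T by case/andP: tT => -> /ltW ->.
have aP : 0 < a by exact: lt_le_trans a1.
have cond := spatial_max_conditions wC vC tT xymax; rewrite -/al in cond.
pose X := del * (chi k x + chi k y).
pose q := eps^-1 *: (x - y).
pose pw := grad w t x; pose pv := grad v t y.
pose S1 := s1 t x; pose S2 := s2 t y.
pose z1 := S1^T *m pw; pose z2 := S2^T *m pv.
have Cg0 : 0 <= Cg.
  apply: mulr_ge0; last by rewrite addr_ge0// sqr_ge0.
  by apply: mulr_ge0 => //; rewrite addr_ge0// mulr_ge0.
have chi0 z : 0 <= chi k z by rewrite exprn_ge0// (le_trans ler01)// sq1_ge1.
have X0 : 0 <= X by apply: mulr_ge0 => //; apply: addr_ge0; exact: chi0.
have XE : del * (Cg * chi k x) + del * (Cg * chi k y) = Cg * X by rewrite /X; ring.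
have ie0 : 0 < eps^-1 by rewrite invr_gt0.
have ie1 : 1 <= eps^-1 by rewrite invf_ge1 ?eps1 ?eps0.
have q0 := frob_ge0 q.
have qE : frob q = eps^-1 * frob (x - y) by rewrite frobZ gtr0_norm.
have qle : frob q <= eps^-1 by rewrite qE ler_piMr// ltW.
have xy0 := frob_ge0 (x - y).
set r2 := eps^-1 * frob (x - y) ^+ 2.
have qr : frob (x - y) * frob q = r2 by rewrite qE /r2; ring.
have r20 : 0 <= r2 by rewrite mulr_ge0 ?sqr_ge0// ltW.
have Hb : frob (b1 t x - b2 t y) <= C * frob (x - y) + D.
  rewrite -(subrKA (b1 t y)) (le_trans (frobD _ _))// lerD//.
  exact: (lip_b lip1).
have Hs : frob (S1 - S2) <= C * frob (x - y) + D.
  rewrite -(subrKA (s1 t y)) (le_trans (frobD _ _))// lerD//.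
  exact: (lip_sigma lip1).
have Hbq : frob (b1 t x - b2 t y) * frob q <= C * r2 + D * eps^-1.
  apply: (le_trans (ler_wpM2r q0 Hb)); rewrite mulrDl -mulrA qr lerD2l ler_wpM2l//.
have Hsq : frob (S1 - S2) * frob q <= C * r2 + D * eps^-1.
  apply: (le_trans (ler_wpM2r q0 Hs)); rewrite mulrDl -mulrA qr lerD2l ler_wpM2l//.
have Hss : eps^-1 * frob (S1 - S2) ^+ 2 <= 2 * C ^+ 2 * r2 + 2 * (eps^-1 * D ^+ 2).
  apply: (@le_trans _ _ (eps^-1 * (C * frob (x - y) + D) ^+ 2)).
    rewrite ler_wpM2l ?(ltW ie0)// ler_sqr ?nnegrE ?frob_ge0//.
    by rewrite addr_ge0// mulr_ge0.
  have := mulr_ge0 (ltW ie0) (sqr_ge0 (C * frob (x - y) - D)).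
  by rewrite /r2; lra.
(* The first-order condition in the pair of drift directions yields the transport terms. *)
have [Ebb _] := cond (b1 t x) (b2 t y).
have Hbb : a * (dotv pw (b1 t x) - al * dotv pv (b2 t y)) <= a * (C * r2 + D *
  eps^-1) + Cg * X.
  have g1 : dotv (grad_chi k x) (b1 t x) <= Cg * chi k x.
    by apply: le_trans (ler_norm _) _; apply: grad_chi_le => //; exact: (growth_b lip1).
  have g2 : dotv (grad_chi k y) (b2 t y) <= Cg * chi k y.
    by apply: le_trans (ler_norm _) _; apply: grad_chi_le => //; exact: (growth_b lip2).
  have := lerD (ler_wpM2l del0 g1) (ler_wpM2l del0 g2).
  have : dotv q (b1 t x - b2 t y) <= C * r2 + D * eps^-1.
    apply: le_trans Hbq; rewrite mulrC; exact: le_trans (ler_norm _) (ler_dotv _ _).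
  rewrite /q dotvZl => /(ler_wpM2l (ltW aP)).
  by move: Ebb; rewrite XE -/pw -/pv; lra.
(* Taken in each pair of columns, the first-order conditions assemble into a vector identity for
   sigma^T times the gradients. It compares [z1] with [al *: z2]. *)
have Ez : a *: (z1 - al *: z2) = a *: ((S1 - S2)^T *m q)
    + del *: (S1^T *m grad_chi k x + S2^T *m grad_chi k y).
  apply/colP => j; have [Ej _] := cond (col j S1) (col j S2).
  have z1E : z1 j 0 = dotv pw (col j S1) := mulTmx_dotv _ _ _.
  have z2E : z2 j 0 = dotv pv (col j S2) := mulTmx_dotv _ _ _.
  have xE : (S1^T *m grad_chi k x) j 0 = dotv (grad_chi k x) (col j S1) :=
    mulTmx_dotv _ _ _.
  have yE : (S2^T *m grad_chi k y) j 0 = dotv (grad_chi k y) (col j S2) :=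
    mulTmx_dotv _ _ _.
  have qE' : ((S1 - S2)^T *m q) j 0 = eps^-1 * dotv (x - y) (col j S1 - col j S2).
    by rewrite mulTmx_dotv /q dotvZl linearB.
  move: z1E z2E xE yE qE'; move: z1 z2 (S1^T *m _) (S2^T *m _) ((S1 - S2)^T *m q)
    => u1 u2 u3 u4 u5 E1 E2 E3 E4 E5.
  rewrite !mxE E1 E2 E3 E4 E5; move: Ej; rewrite -/pw -/pv; lra.
have Z0 := frob_ge0 z2.
have g1 : frob (S1^T *m grad_chi k x) <= Cg * chi k x.
  by apply: mulTmx_grad_chi_le => //; exact: (growth_sigma lip1).
have g2 : frob (S2^T *m grad_chi k y) <= Cg * chi k y.
  by apply: mulTmx_grad_chi_le => //; exact: (growth_sigma lip2).
have al1 : 1 <= al.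
  by rewrite /al; move: vA; rewrite ler_norml => /andP[_ vA]; have := ltW gam0; nra.
have alle : al - 1 <= 4 * gam * A.
  by rewrite /al; move: vA; rewrite ler_norml => /andP[vA _]; have := ltW gam0; nra.
have Hz : a * frob (z1 - z2) <= a * (C * r2 + D * eps^-1) + Cg * X + a * (4 * gam
  * A * frob z2).
  (* The correction [(al - 1) *: z2] is linear in [z2] with a coefficient of order [gam]; completing
     the square against [gam * |z2|^2] therefore leaves an error that is still of order [gam]. *)
  have -> : z1 - z2 = (z1 - al *: z2) + (al - 1) *: z2.
    by clear; move: z1 z2 => u1 u2; apply/colP => j; rewrite !mxE; ring.
  apply: (le_trans (ler_wpM2l (ltW aP) (frobD _ _))); rewrite mulrDr lerD//; last first.
    rewrite frobZ ger0_norm ?subr_ge0// ler_wpM2l ?(ltW aP)// ler_wpM2r//.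
  rewrite -[X in X * frob _]gtr0_norm// -frobZ Ez (le_trans (frobD _ _))//.
  rewrite !frobZ gtr0_norm// ger0_norm// lerD//.
    rewrite ler_wpM2l ?(ltW aP)//; apply: le_trans Hsq; exact: frob_mulTmx.
  rewrite -XE -mulrDr ler_wpM2l// (le_trans (frobD _ _))// lerD//.
have Htr : a * (\tr (S1 *m S1^T *m hess w t x) - al * \tr (S2 *m S2^T *m hess v t y))
    <= 2 * (Cg * X) + a * (2 * C ^+ 2 * r2 + 2 * (eps^-1 * D ^+ 2)) - 2 * a * gam
      * frob z2 ^+ 2.
  have h1 := hess_chi_le k C0 (growth_sigma lip1 tT' x).
  have h2 := hess_chi_le k C0 (growth_sigma lip2 tT' y).
  have hh := lerD (ler_wpM2l del0 h1) (ler_wpM2l del0 h2).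
  have hsum : a * (\tr (S1 *m S1^T *m hess w t x) - al * \tr (S2 *m S2^T *m hess v t y)
      + 2 * gam * frob z2 ^+ 2 - eps^-1 * frob (S1 - S2) ^+ 2)
     <= del * (\sum_j hess_chi k x (col j S1) + \sum_j hess_chi k y (col j S2)).
    have sD : frob (S1 - S2) ^+ 2 = \sum_j dotv (col j S1 - col j S2) (col j S1 -
      col j S2).
      by rewrite -sum_dotvv_col; apply: eq_bigr => j _; rewrite linearB.
    apply: (quadratic_sum_le (trace_qform S1 _) (trace_qform S2 _)
      (esym (sum_dotv_col S2 pv)) sD) => j.
    by case: (cond (col j S1) (col j S2)).
  have hC := ler_wpM2l (ltW aP) Hss.
  exact: trace_arith hsum hh XE hC.
have HF1 : f1 t x (w t x) z1 - f1 t x (v t y) z2 <= C * (`|w t x - v t y| + frob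
  (z1 - z2)).
  exact: le_trans (ler_norm _) (lip_f lip1 _ _ _ _ _ tT').
have HF2 : f1 t x (v t y) z2 - f2 t y (v t y) z2 <= eta + D + 2^-1 * (gam * frob
  z2 ^+ 2).
  have gZ : 0 <= 2^-1 * (gam * frob z2 ^+ 2) by rewrite mulr_ge0// mulr_ge0
    ?sqr_ge0// ltW.
  have [zN|Nz] := leP (frob z2) N.
    by apply: le_trans (HDf _ zN) _; rewrite lerDl.
  have e1 := growth_f lip1 tT' x (v t y) z2.
  have e2 := growth_f lip2 tT' y (v t y) z2.
  apply: large_gradient_arith e1 e2 Hf1 Hf2 HN N1 (ltW Nz) => //.
  exact: ltW.
(* The supersolution inequality enters multiplied by [al], so [f2] carries the factor [al] while
   [f1] carries 1; this bounds the mismatch. *)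
have HF3 : (1 - al) * f2 t y (v t y) z2 <= 4 * gam * A * (Kf + C * frob z2).
  have e2 : `|f2 t y (v t y) z2| <= Kf + C * frob z2.
    by apply: le_trans (growth_f lip2 tT' y (v t y) z2) _; rewrite lerD2r.
  apply: le_trans (ler_norm _) _; rewrite normrM ler_pM// distrC ger0_norm// subr_ge0//.
have aB0 : 0 <= B.
  by rewrite -(pmulr_rge0 _ aP); exact: le_trans HX.
have Hdwv : `|w t x - v t y| <= B + 2^-1 * r2 + 4 * gam * A ^+ 2.
  apply: (value_gap_arith vA (ltW gam0) r20 aB0).
  by rewrite /B /r2 dotvv invfM mulrA.
have b1E : dotv (b1 t x) (grad w t x) = dotv pw (b1 t x) by rewrite dotvC.
have b2E : dotv (b2 t y) (grad v t y) = dotv pv (b2 t y) by rewrite dotvC.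
rewrite /parabolic_op b1E -/z1 in Hw.
rewrite /parabolic_op b2E -/z2 in Hv.
exact: (doubling_arith (ltW aP) (le_trans ler01 al1) C0 Cg0 ie1 D0 (ltW gam0) aB0
  Hw Hv Ht Hbb Htr HF1 HF2 HF3 Hz Hdwv HX Hmu).
Qed.
End DoublingInequality.

(** * The optimality condition in time *)

Section TimeMaximum.
Variables (R : realType) (d : nat) (T : R).
Local Notation E := 'cV[R]_d.
Implicit Types (u w v : R -> E -> R) (t : R) (x y : E).

Lemma time_quot_right u t x : C12 T u -> 0 <= t < T ->
  time_quot u t x s @[s --> t^'+] --> dt T u t x.
Proof.
move=> uC /[dup] tT /andP[t0 tT']; apply: cvg_trans (@C12_dt _ _ _ _ uC t x tT);
  apply: cvg_app => A tA.
have {}tA : nbhs t (fun s : R => s != t -> `[0, T]%classic s -> A s) by exact: tA.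
apply: filterS2 (lt_nbhsl tT') tA => s sT As ts.
apply: As; first by rewrite gt_eqF.
by rewrite /= in_itv/= (le_trans t0 (ltW ts)) ltW.
Qed.

Lemma time_cvg_right u t x : C12 T u -> 0 <= t < T ->
  u s x @[s --> t^'+] --> u t x.
Proof.
move=> uC tT.
have H : u t x + (s - t) * time_quot u t x s @[s --> t^'+] --> u t x + (t - t) *
  dt T u t x.
  apply: cvgD; first exact: cvg_cst.
  apply: cvgM; last exact: time_quot_right.
  by apply: cvgB; [exact/cvg_at_right_filter/cvg_id|exact: cvg_cst].
rewrite subrr mul0r addr0 in H; apply: cvg_trans H; apply: near_eq_cvg.
near=> s; have st : s - t != 0 by rewrite subr_eq0 gt_eqF//; near: s; exact:
  nbhs_right_gt.
by rewrite /time_quot mulrA divff// mul1r addrC subrK.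
Unshelve. all: by end_near. Qed.

(** Only increments to the right are used: the maximum may sit at time 0, and the slope of [F] is
    controlled only on the right. *)
Lemma time_max_condition w v t x y (F : R -> R) (mu gam A q X G : R) :
  let beta s := w s x - v s y + gam * (v s y - A) ^+ 2 - q in
  C12 T w -> C12 T v -> 0 <= t < T -> 0 <= mu -> 0 <= beta t ->
  (forall s, t < s <= T ->
    expR (mu * s) * beta s - X - F s <= expR (mu * t) * beta t - X - F t) ->
  (\forall s \near t^'+, F s <= F t - G * (s - t)) ->
  expR (mu * t) * (dt T w t x - (1 - 2 * gam * (v t y - A)) * dt T v t y
    + mu * beta t) <= - G.
Proof.
move=> beta wC vC tT mu0 beta0 tmax FG.
have qw := @time_quot_right w t x wC tT.
have qv := @time_quot_right v t y vC tT.
have vt := @time_cvg_right v t y vC tT.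
(* Difference quotient of [expR (mu * s) * beta s], with the increment of the exponential replaced
   by its tangent lower bound, which is legitimate because [beta t] is nonnegative. The square is
   factored as a difference of squares, so that only the quotients of [w] and [v] have to
   converge. *)
pose Q s := expR (mu * s) * (time_quot w t x s - time_quot v t y s
    + gam * (time_quot v t y s * (v s y + v t y - 2 * A)))
  + expR (mu * t) * (mu * beta t).
have QL : Q s @[s --> t^'+] --> expR (mu * t) * (dt T w t x - dt T v t y
    + gam * (dt T v t y * (v t y + v t y - 2 * A)))
  + expR (mu * t) * (mu * beta t).
  apply: cvgD; last exact: cvg_cst.
  apply: cvgM.
    apply: (cvg_comp (fun s => mu * s) expR); last exact: continuous_expR.
    by apply: cvgM; [exact: cvg_cst|exact/cvg_at_right_filter/cvg_id].
  apply: cvgD; first exact: cvgB.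
  apply: cvgM; first exact: cvg_cst.
  apply: cvgM => //; apply: cvgB; last exact: cvg_cst.
  by apply: cvgD => //; exact: cvg_cst.
have := cvgr_to_le (b := - G) QL _.
rewrite (_ : _ + _ = expR (mu * t) * (dt T w t x - (1 - 2 * gam * (v t y - A)) *
  dt T v t y + mu * beta t)); last by ring.
apply; near=> s.
have ts : t < s by near: s; exact: nbhs_right_gt.
have sT : s <= T by near: s; apply: nbhs_right_le; case/andP: tT.
have FGs : F s <= F t - G * (s - t) by near: s.
have st0 : 0 < s - t by rewrite subr_gt0.
rewrite -(ler_pM2l st0).
have E1 z u : (s - t) * time_quot u t z s = u s z - u t z.
  by rewrite /time_quot mulrA divff ?mul1r// gt_eqF.
have -> : (s - t) * Q s = expR (mu * s) * (beta s - beta t)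
    + expR (mu * t) * (mu * (s - t)) * beta t.
  rewrite (_ : _ * Q s = expR (mu * s) * ((s - t) * time_quot w t x s
    - (s - t) * time_quot v t y s
    + gam * ((s - t) * time_quot v t y s * (v s y + v t y - 2 * A)))
    + expR (mu * t) * (mu * (s - t)) * beta t); last by rewrite /Q; ring.
  by rewrite !E1 /beta; ring.
have e1 : expR (mu * t) * (mu * (s - t)) <= expR (mu * s) - expR (mu * t).
  have -> : mu * s = mu * t + mu * (s - t) by ring.
  rewrite expRD -[X in _ <= _ - X]mulr1 -mulrBr ler_pM2l ?expR_gt0//.
  by have := expR_ge1Dx (mu * (s - t)); lra.
have e2 := ler_wpM2r beta0 e1.
have tm : expR (mu * s) * beta s - X - F s <= expR (mu * t) * beta t - X - F t.
  by apply: tmax; rewrite ts sT.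
move: e2 FGs tm; move: (beta s) (beta t) (expR _) (expR _) (F s) (F t) => bs bt
  es et Fs Ft.
by clear; lra.
Unshelve. all: by end_near. Qed.

End TimeMaximum.

(** * Existence of a maximum of the doubled function *)

Section Maximizers.
Variable R : realType.

(** The function M S^k - del S^(k+2) is at most [K] everywhere on S >= 1 and at most -K beyond [r].
    Hence one large variable makes up for the other, wherever that one lies. *)
Lemma boundary_radius (M del : R) (k : nat) : 0 <= M -> 0 < del ->
  exists2 r : R, 1 <= r & forall S S' : R, 1 <= S -> 1 <= S' -> r < S \/ r < S' ->
    M * (S ^+ k + S' ^+ k) <= del * (S ^+ k.+2 + S' ^+ k.+2).
Proof.
move=> M0 del0.
(* Beyond [L] the weight already dominates; below [L] the growth term is at most [K]. *)
pose L := M / del + 1; pose K := M * L ^+ k.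
have L1 : 1 <= L by rewrite lerDr divr_ge0// ltW.
have K0 : 0 <= K by rewrite mulr_ge0// exprn_ge0// (le_trans ler01).
pose r := (M + K) / del + 1.
have upper S : 1 <= S -> M * S ^+ k - del * S ^+ k.+2 <= K.
  move=> S1; have S0 : 0 <= S := le_trans ler01 S1.
  have [SL|LS] := leP S L.
    apply: (@le_trans _ _ (M * S ^+ k)); first by rewrite gerBl mulr_ge0
      ?exprn_ge0// ltW.
    by rewrite ler_wpM2l// lerXn2r// nnegrE// (le_trans S0).
  have MS : M <= del * S by rewrite mulrC -ler_pdivrMr// (le_trans _ (ltW LS))// lerDl.
  apply: le_trans K0; rewrite subr_le0.
  have -> : del * S ^+ k.+2 = del * S * S * S ^+ k by rewrite !exprS; ring.
  rewrite ler_wpM2r ?exprn_ge0//; apply: (le_trans MS).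
  by rewrite ler_peMr// mulr_ge0// ltW.
have lower S : 1 <= S -> r < S -> M * S ^+ k - del * S ^+ k.+2 <= - K.
  move=> S1 rS; have S0 : 0 <= S := le_trans ler01 S1.
  have e1 : M + K <= del * S.
    by rewrite mulrC -ler_pdivrMr// (le_trans _ (ltW rS))// lerDl.
  have e2 : 1 <= S ^+ k by rewrite exprn_ege1.
  have e3 : del * S * S ^+ k <= del * S ^+ k.+2.
    rewrite -mulrA ler_wpM2l ?(ltW del0)// [S ^+ k.+2]exprS ler_wpM2l//.
    by rewrite exprS ler_peMl// exprn_ge0.
  have e4 := ler_wpM2r (exprn_ge0 k S0) e1.
  have e5 := ler_wpM2l K0 e2.
  lra.
exists r; first by rewrite lerDr divr_ge0 ?addr_ge0// ltW.
move=> S S' S1 S1' [/lower|/lower] H.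
  by have := H S1; have := upper S' S1'; lra.
by have := H S1'; have := upper S S1; lra.
Qed.

Lemma growth_arith (P Sx Sy W V V2 gg dd : R) : 0 <= P ->
  W <= P * Sx -> - V <= P * Sy -> V2 <= P ^+ 2 * Sy -> 0 <= dd ->
  gg <= 2 * V2 + 2 -> 1 <= Sx -> 1 <= Sy ->
  W - V + gg - dd <= (P + 2 * P ^+ 2 + 2) * (Sx + Sy).
Proof.
move=> P0 hW hV hV2 d0 hg x1 y1.
have x0 := le_trans ler01 x1.
have := mulr_ge0 (sqr_ge0 P) x0; lra.
Qed.

Section ColumnVectors.
Variable d : nat.
Local Notation E := 'cV[R]_d.

(** Heine-Borel for row vectors, carried over by the transpose, which does not increase the max norm
    in either direction. *)
Lemma compact_ball_cV (r : R) : compact [set x : E | `|x| <= r].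
Proof.
have cB : compact [set x : 'rV[R]_d | `|x| <= r].
  apply: bounded_closed_compact.
    exists r; split; first exact: num_real.
    by move=> s rs x /= xr; exact: le_trans xr (ltW rs).
  apply: (@closed_comp _ _ (fun x : 'rV[R]_d => `|x|) [set z | z <= r]).
    by move=> x _; exact: norm_continuous.
  exact: closed_le.
have trn m n (x : 'M[R]_(m, n)) : `|x^T| <= `|x|.
  rewrite [leLHS]/Num.norm [leRHS]/Num.norm/= !mx_normrE; apply/bigmax_leP; split.
    by apply: bigmax_ge_id.
  move=> [i j] _ /=; rewrite mxE; apply/bigmax_geP; right.
  by exists (j, i).
have trc : continuous (@trmx R 1 d).
  move=> x; apply/(@cvgrPdist_lt _ _ _ _ (nbhs_filter x)) => e e0.
  apply: filterS (nbhsx_ballx x e e0) => y; rewrite -ball_normE/= => xy.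
  by rewrite -linearB; exact: le_lt_trans (trn _ _ _) xy.
have := @continuous_compact _ _ (@trmx R 1 d) _ (continuous_subspaceT trc) cB.
rewrite (_ : _ @` _ = [set x : E | `|x| <= r])//.
apply/seteqP; split=> [_ [x /= xr <-]|x /= xr].
  exact: le_trans (trn _ _ _) xr.
by exists x^T; [exact: le_trans (trn _ _ _) xr|rewrite trmxK].
Qed.

Lemma cvg_dotv (V : Type) (F : set_system V) {FF : Filter F} (p q : V -> E) (a b : E) :
  p z @[z --> F] --> a -> q z @[z --> F] --> b ->
  dotv (p z) (q z) @[z --> F] --> dotv a b.
Proof.
move=> pa qb; apply: cvg_big => [|i _]; first exact: add_continuous.
have pi : p z i 0 @[z --> F] --> a i 0.
  exact: (@cvg_comp _ _ _ p (fun M : E => M i 0) F _ _ pa (@coord_continuous _ _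
    _ i 0 a)).
have qi : q z i 0 @[z --> F] --> b i 0.
  exact: (@cvg_comp _ _ _ q (fun M : E => M i 0) F _ _ qb (@coord_continuous _ _
    _ i 0 b)).
exact: cvgM.
Qed.

Lemma cvg_within_comp (U V W : topologicalType) (A : set U) (B : set V)
    (phi : U -> V) (g : V -> W) (x : U) :
  {within B, continuous g} -> {for x, continuous phi} ->
  (forall z, A z -> B (phi z)) -> A x ->
  g (phi z) @[z --> within A (nbhs x)] --> g (phi x).
Proof.
move=> /subspace_continuousP gB phic AB Ax.
have Fx : phi @ within A (nbhs x) --> within B (nbhs (phi x)).
  move=> C BC; have nC : nbhs x (fun z => B (phi z) -> C (phi z)) := phic _ BC.
  by apply: filterS nC => z zC Az; exact/zC/AB.
exact: cvg_comp Fx (gB _ (AB _ Ax)).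
Qed.

Variables (T : R) (w v : R -> E -> R) (F : R -> R) (k0 : nat).
Variables (P mu gam A q del r : R).

(* Time is not doubled: the approximations are classical, so the right time
   derivative at a maximum is available. *)
Definition doubled (t : R) (x y : E) : R :=
  expR (mu * t) * (w t x - v t y + gam * (v t y - A) ^+ 2
    - q * dotv (x - y) (x - y))
  - del * (chi (k0 + k0) x + chi (k0 + k0) y) - F t.

Let Q := P + 2 * P ^+ 2 + 2.

Hypothesis wc : {within strip T, continuous (fun p : R * E => w p.1 p.2)}.
Hypothesis vc : {within strip T, continuous (fun p : R * E => v p.1 p.2)}.
Hypothesis Fc : continuous F.
Hypothesis F0 : forall t, 0 <= t <= T -> 0 <= F t.
Hypothesis P0 : 0 <= P.
Hypothesis wP : forall t x, 0 <= t <= T -> `|w t x| <= P * sq1 x ^+ k0.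
Hypothesis vP : forall t x, 0 <= t <= T -> `|v t x| <= P * sq1 x ^+ k0.
Hypothesis gam01 : 0 <= gam <= 1.
Hypothesis gamA : gam * A ^+ 2 <= 1.
Hypothesis q0 : 0 <= q.
Hypothesis mu0 : 0 <= mu.
Hypothesis rP : forall S S' : R, 1 <= S -> 1 <= S' -> r < S \/ r < S' ->
  expR (mu * T) * Q * (S ^+ (k0 + k0) + S' ^+ (k0 + k0))
    <= del * (S ^+ (k0 + k0).+2 + S' ^+ (k0 + k0).+2).

(** The square of v - A doubles the growth exponent [k0], which is why the weight is
    [chi (k0 + k0)]. The conditions on [gam] bound gam (v-A)^2 by 2 v^2 + 2, so that the radius [r]
    depends neither on [gam] nor on [A]; this allows [A] to be defined from [r]. *)
Lemma doubled_le0 t x y : 0 <= t <= T -> r < sq1 x \/ r < sq1 y ->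
  doubled t x y <= 0.
Proof.
move=> tT xy; rewrite /doubled -addrA -opprD subr_le0.
apply: (@le_trans _ _ (del * (chi (k0 + k0) x + chi (k0 + k0) y))); last first.
  by rewrite lerDl F0.
apply: le_trans (rP (sq1_ge1 x) (sq1_ge1 y) xy).
case/andP: gam01 => g0 g1; case/andP: tT (tT) => t0 tT' tT.
have grow (z : E) : sq1 z ^+ k0 <= sq1 z ^+ (k0 + k0) /\ 1 <= sq1 z ^+ (k0 + k0).
  by rewrite exprn_ege1 ?sq1_ge1// ler_weXn2l ?sq1_ge1// leq_addr.
have [x1 x2] := grow x; have [y1 y2] := grow y.
have hw := le_trans (ler_norm _) (le_trans (wP x tT) (ler_wpM2l P0 x1)).
have hv : - v t y <= P * sq1 y ^+ (k0 + k0).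
  rewrite lerNl; have := le_trans (vP y tT) (ler_wpM2l P0 y1).
  by rewrite ler_norml => /andP[].
have hv2 : v t y ^+ 2 <= P ^+ 2 * sq1 y ^+ (k0 + k0).
  rewrite exprD -[sq1 y ^+ k0 * _]expr2 -exprMn -(real_normK (num_real (v t y))).
  by rewrite ler_sqr ?nnegrE ?mulr_ge0// ?vP// exprn_ge0// (le_trans ler01 (sq1_ge1 y)).
have hd := mulr_ge0 q0 (dotvv_ge0 (x - y)).
have hg : gam * (v t y - A) ^+ 2 <= 2 * v t y ^+ 2 + 2.
  have e1 := mulr_ge0 g0 (sqr_ge0 (v t y + A)).
  have e2 := ler_wpM2r (sqr_ge0 (v t y)) g1.
  by move: e1 e2 gamA; lra.
rewrite -mulrA; apply: (@le_trans _ _ (expR (mu * t) * (Q * (sq1 x ^+ (k0 + k0) +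
  sq1 y ^+ (k0 + k0))))).
  by rewrite ler_wpM2l ?expR_ge0//; exact: growth_arith hw hv hv2 hd hg x2 y2.
rewrite ler_wpM2r//.
  rewrite mulr_ge0 ?addr_ge0 ?mulr_ge0 ?sqr_ge0//.
    by rewrite (le_trans ler01).
  by rewrite (le_trans ler01).
by rewrite ler_expR ler_wpM2l.
Qed.

(** The doubled function is nonpositive wherever [sq1 x] or [sq1 y] exceeds [r], and positive at one
    point. Its maximum over a compact set containing the remaining region is thus global. *)
Lemma doubled_has_max t0 x0 : 0 <= t0 <= T -> 0 < doubled t0 x0 x0 -> 1 <= r ->
  exists t x y, [/\ 0 <= t <= T, sq1 x <= r, sq1 y <= r &
    forall t' x' y', 0 <= t' <= T -> doubled t' x' y' <= doubled t x y].
Proof.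
move=> t0T pos r1.
pose K : set (R * E * E) := (`[0, T] `*` [set x | `|x| <= r]) `*` [set x | `|x| <= r].
have cK : compact K.
  apply: compact_setX; last exact: compact_ball_cV.
  by apply: compact_setX; [exact: segment_compact|exact: compact_ball_cV].
have inball (x : E) : sq1 x <= r -> `|x| <= r.
  move=> xr; apply: (le_trans (normr_le_frob x)).
  have f0 := frob_ge0 x.
  rewrite -ler_sqr ?nnegrE ?(le_trans ler01 r1)// -dotvv.
  move: xr r1; rewrite /sq1; have := dotvv_ge0 x; move: (dotv x x) => D; nra.
have inr t x y : 0 <= t <= T -> 0 < doubled t x y -> sq1 x <= r /\ sq1 y <= r.
  move=> tT dpos; split; rewrite leNgt; apply/negP => xr.
    by move: dpos; rewrite ltNge doubled_le0//; left.
  by move: dpos; rewrite ltNge doubled_le0//; right.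
have Kin t x y : 0 <= t <= T -> 0 < doubled t x y -> K (t, x, y).
  move=> tT /(inr _ _ _ tT)[xr yr]; rewrite /K /= in_itv/=.
  by split; [split=> //|]; exact: inball.
have cD : {within K, continuous (fun p : R * E * E => doubled p.1.1 p.1.2 p.2)}.
  apply/subspace_continuousP => -[[t x] y] Kp.
  have c11 : fst (fst z) @[z --> within K (nbhs (t, x, y))] --> t.
    by apply: cvg_within_filter; apply: (cvg_comp fst fst); [exact:
      cvg_fst|exact: cvg_fst].
  have c12 : snd (fst z) @[z --> within K (nbhs (t, x, y))] --> x.
    by apply: cvg_within_filter; apply: (cvg_comp fst snd); [exact:
      cvg_fst|exact: cvg_snd].
  have c2 : snd z @[z --> within K (nbhs (t, x, y))] --> y.
    by apply: cvg_within_filter; exact: cvg_snd.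
  have Kstrip (z : R * E * E) : K z -> 0 <= z.1.1 <= T.
    by case=> -[/= zT _ _]; rewrite in_itv in zT.
  have cw : w z.1.1 z.1.2 @[z --> within K (nbhs (t, x, y))] --> w t x.
    have H : {for (t, x, y), continuous (fst : R * E * E -> R * E)} by exact: cvg_fst.
    exact: (cvg_within_comp wc H Kstrip Kp).
  have cv : v z.1.1 z.2 @[z --> within K (nbhs (t, x, y))] --> v t y.
    have H1 : fst (fst z) @[z --> nbhs (t, x, y)] --> t.
      by apply: (cvg_comp fst fst); [exact: cvg_fst|exact: cvg_fst].
    have H2 : snd z @[z --> nbhs (t, x, y)] --> y by exact: cvg_snd.
    have H : {for (t, x, y), continuous (fun z : R * E * E => (z.1.1, z.2))}.
      exact: cvg_pair H1 H2.
    exact: (cvg_within_comp vc H Kstrip Kp).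
  have cchi (G : set_system (R * E * E)) (p : R * E * E -> E) (a : E) : Filter G ->
      p z @[z --> G] --> a -> chi (k0 + k0) (p z) @[z --> G] --> chi (k0 + k0) a.
    move=> FG pa; have sa : sq1 (p z) @[z --> G] --> sq1 a.
      rewrite /sq1; apply: cvgD; first exact: cvg_cst.
      exact: (cvg_dotv pa pa).
    exact: (cvg_comp (fun z => sq1 (p z)) _ sa (@exprn_continuous _ _ _)).
  have cxy : z.1.2 - z.2 @[z --> within K (nbhs (t, x, y))] --> x - y by exact: cvgB.
  rewrite /doubled /=; apply: cvgB; last by apply: (cvg_comp _ F c11); exact: Fc.
  apply: cvgB; last first.
    by apply: cvgM; [exact: cvg_cst|apply: cvgD; exact: cchi].
  apply: cvgM.
    apply: (cvg_comp (fun z : R * E * E => mu * z.1.1) expR); last exact: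
      continuous_expR.
    by apply: cvgM => //; exact: cvg_cst.
  apply: cvgB; last by apply: cvgM; [exact: cvg_cst|exact: (cvg_dotv cxy cxy)].
  apply: cvgD; first exact: cvgB.
  apply: cvgM; first exact: cvg_cst.
  have cvA : v z.1.1 z.2 - A @[z --> within K (nbhs (t, x, y))] --> v t y - A.
    by apply: cvgB => //; exact: cvg_cst.
  under eq_fun do rewrite expr2.
  by rewrite expr2; exact: cvgM.
have K0 : K !=set0 by exists (t0, x0, x0); exact: Kin.
have [[[t x] y] /set_mem Kp pmax] := compact_EVT_max K0 cK cD.
have dmax t' x' y' : 0 <= t' <= T -> doubled t' x' y' <= doubled t x y.
  move=> tT'; have [dpos|dneg] := ltP 0 (doubled t' x' y').
    by apply: (pmax (t', x', y')); exact/mem_set/Kin.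
  apply: (le_trans dneg); apply/ltW; apply: (lt_le_trans pos).
  by apply: (pmax (t0, x0, x0)); exact/mem_set/Kin.
have tT : 0 <= t <= T by case: Kp => -[/=]; rewrite in_itv.
have [xr yr] := inr t x y tT (lt_le_trans pos (dmax _ _ _ t0T)).
by exists t, x, y.
Qed.

End ColumnVectors.
End Maximizers.

(** * Contradiction at the maximum for suitable parameters *)

(** The value at (x,y) is compared with the values at both diagonal points (x,x) and (y,y); in the
    sum of the two comparisons the weights cancel. The factor 5 is 1 from -v plus 4 from gam
    (v-A)^2, since |2A - Vx - Vy| <= 4A and gam A <= 1. *)
Lemma penalty_arith (R : realType) (Wx Wy Vx Vy gam A r2 : R) :
  0 <= gam -> gam * A <= 1 -> `|Vx| <= A -> `|Vy| <= A ->
  (Wx - Vx + gam * (Vx - A) ^+ 2) + (Wy - Vy + gam * (Vy - A) ^+ 2)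
    <= 2 * (Wx - Vy + gam * (Vy - A) ^+ 2 - 2^-1 * r2) ->
  r2 <= `|Wx - Wy| + 5 * `|Vx - Vy|.
Proof.
move=> gam0 gA; rewrite !ler_norml => /andP[x1 x2] /andP[y1 y2] H.
have hw := ler_norm (Wx - Wy); have hv := ler_norm (Vx - Vy).
have e : gam * ((Vx - Vy) * (2 * A - Vx - Vy)) <= 4 * `|Vx - Vy|.
  apply: (@le_trans _ _ (gam * (`|Vx - Vy| * (4 * A)))).
    rewrite ler_wpM2l//; apply: (@le_trans _ _ (`|Vx - Vy| * (2 * A - Vx - Vy))).
      by rewrite ler_wpM2r//; lra.
    by rewrite ler_wpM2l//; lra.
  have := ler_wpM2r (normr_ge0 (Vx - Vy)) gA; lra.
lra.
Qed.

Section DoublingContradiction.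
Variables (R : realType) (d : nat) (T C : R).
Local Notation E := 'cV[R]_d.
Variables (b1 b2 : R -> E -> E) (s1 s2 : R -> E -> 'M[R]_d).
Variables (f1 f2 : R -> E -> R -> E -> R) (h1 h2 : E -> R) (w v : R -> E -> R).
Hypothesis C0 : 0 <= C.
Hypothesis lip1 : lipschitz_coefs T C b1 s1 f1.
Hypothesis lip2 : lipschitz_coefs T C b2 s2 f2.
Hypothesis subw : classical_subsolution T b1 s1 f1 h1 w.
Hypothesis supv : classical_supersolution T b2 s2 f2 h2 v.
Variables (P : R) (k0 : nat).
Hypothesis P0 : 0 <= P.
Hypothesis wP : forall t x, 0 <= t <= T -> `|w t x| <= P * sq1 x ^+ k0.
Hypothesis vP : forall t x, 0 <= t <= T -> `|v t x| <= P * sq1 x ^+ k0.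
Hypothesis f1P : forall t x, 0 <= t <= T -> `|f1 t x 0 0| <= P * sq1 x ^+ k0.
Hypothesis f2P : forall t x, 0 <= t <= T -> `|f2 t x 0 0| <= P * sq1 x ^+ k0.
Variables (mu del r A Kf gam N rho eps eta zeta kap : R) (F D G : R -> R).
Let M := expR (mu * T).
Hypothesis mu0 : 0 <= mu.
Hypothesis muC : C + (2 + C) * growth_cst (k0 + k0) C <= mu.
Hypothesis del0 : 0 < del.
Hypothesis r1 : 1 <= r.
Hypothesis rP : forall S S' : R, 1 <= S -> 1 <= S' -> r < S \/ r < S' ->
  M * (P + 2 * P ^+ 2 + 2) * (S ^+ (k0 + k0) + S' ^+ (k0 + k0))
    <= del * (S ^+ (k0 + k0).+2 + S' ^+ (k0 + k0).+2).
Hypothesis AE : P * r ^+ k0 <= A.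
Hypothesis A1 : 1 <= A.
Hypothesis KfE : A + C * A <= Kf.
Hypothesis gam0 : 0 < gam.
Hypothesis gam1 : gam <= 1.
Hypothesis gamA : gam * A ^+ 2 <= 1.
Hypothesis NK : 4 * (Kf + C) <= gam * N.
Hypothesis N1 : 1 <= N.
Hypothesis rho01 : 0 < rho <= 1.
Hypothesis eps01 : 0 < eps <= 1.
Hypothesis epsA : 12 * A * eps < rho ^+ 2.
Hypothesis eta0 : 0 <= eta.
Hypothesis equi : forall t x y, 0 <= t <= T -> sq1 x <= r -> sq1 y <= r ->
  frob (x - y) < rho ->
  [/\ `|w t x - w t y| <= eta, `|v t x - v t y| <= eta, `|h1 x - h1 y| <= eta &
    forall a z, `|a| <= A -> frob z <= N -> `|f1 t x a z - f1 t y a z| <= eta].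
Hypothesis F0 : forall t, 0 <= t <= T -> 0 <= F t.
Hypothesis Fc : continuous F.
Hypothesis FG : forall t, 0 <= t < T ->
  \forall s \near t^'+, F s <= F t - G t * (s - t).
Hypothesis D0 : forall t, 0 <= D t.
Hypothesis diffD : forall t y, 0 <= t <= T -> sq1 y <= r ->
  [/\ frob (b1 t y - b2 t y) <= D t, frob (s1 t y - s2 t y) <= D t &
    forall a z, `|a| <= A -> frob z <= N -> f1 t y a z - f2 t y a z <= D t].
Hypothesis diffh : forall y, sq1 y <= r -> h1 y - h2 y <= zeta.
Hypothesis DG : forall t, 0 <= t < T ->
  M * ((3 / 2 * C + 2 * C ^+ 2) * (6 * eta)
    + eps^-1 * ((2 + C) * D t + D t ^+ 2) + eta
    + gam * (4 * C * A ^+ 2 + 4 * A * Kf + 32 * A ^+ 2 * C ^+ 2)) < G t.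
Hypothesis kap0 : 0 < kap.
Hypothesis terminal : M * (eta + zeta + 4 * gam * A ^+ 2) < kap.

Lemma doubling_contradiction t0 x0 : 0 <= t0 <= T ->
  doubled w v F k0 mu gam A (2 * eps)^-1 del t0 x0 x0 < kap.
Proof.
move=> t0T; rewrite ltNge; apply/negP => kapmax.
case: subw => wC wpde wT; case: supv => vC vpde vT.
have [eps0 eps1] := andP eps01; have [rho0 rho1] := andP rho01.
have q0 : 0 <= (2 * eps)^-1 by rewrite invr_ge0 mulr_ge0// ltW.
have gam01 : 0 <= gam <= 1 by rewrite (ltW gam0) gam1.
have A0 : 0 <= A := le_trans ler01 A1.
have [t [x [y [tT xr yr dmax]]]] := doubled_has_max (C12_cont wC) (C12_cont vC)
  Fc F0 P0 wP vP gam01 gamA q0 mu0 rP t0T (lt_le_trans kap0 kapmax) r1.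
have dkap := le_trans kapmax (dmax _ _ _ t0T).
have [t00 tleT] := andP tT.
have PA (z : E) : sq1 z <= r -> P * sq1 z ^+ k0 <= A.
  move=> zr; apply: le_trans AE; rewrite ler_wpM2l// lerXn2r// nnegrE.
    exact: le_trans ler01 (sq1_ge1 z).
  exact: le_trans ler01 r1.
have wA (z : E) : sq1 z <= r -> `|w t z| <= A.
  by move=> zr; exact: (le_trans (wP z tT) (PA z zr)).
have vA (z : E) : sq1 z <= r -> `|v t z| <= A.
  by move=> zr; exact: (le_trans (vP z tT) (PA z zr)).
set r2 := eps^-1 * frob (x - y) ^+ 2.
have r2E : (2 * eps)^-1 * dotv (x - y) (x - y) = 2^-1 * r2.
  by rewrite dotvv /r2 invfM mulrA.
have a0 : 0 < expR (mu * t) := expR_gt0 _.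
have r2le : r2 <= `|w t x - w t y| + 5 * `|v t x - v t y|.
  have gA : gam * A <= 1.
    apply: le_trans gamA; rewrite ler_wpM2l ?(ltW gam0)// expr2 ler_peMr//.
  apply: (penalty_arith (ltW gam0) gA (vA x xr) (vA y yr)).
  have z0 (z : E) : (2 * eps)^-1 * dotv (z - z) (z - z) = 0.
    by rewrite subrr dotvv frob0 expr0n mulr0.
  have mx := dmax t x x tT; have my := dmax t y y tT.
  rewrite /doubled z0 r2E subr0 in mx; rewrite /doubled z0 r2E subr0 in my.
  rewrite -(ler_pM2l a0).
  move: mx my; move: (expR (mu * t)) (chi _ x) (chi _ y) (F t) => a X Y Ft; lra.
(* A bootstrap: the bounds by [A] alone give [r2 <= 12 * A], so by the choice of [eps] the points
   are closer than [rho]. Only then do the moduli apply, and put back into [r2le] they improve the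
   bound to [6 * eta]. *)
have xy_rho : frob (x - y) < rho.
  have h1x := ler_normB (w t x) (w t y); have h2x := ler_normB (v t x) (v t y).
  have r212 : r2 <= 12 * A.
    have := wA x xr; have := wA y yr; have := vA x xr; have := vA y yr; lra.
  rewrite -ltr_sqr ?nnegrE ?frob_ge0 ?(ltW rho0)//.
  apply: le_lt_trans epsA; rewrite -ler_pdivrMr// mulrC; exact: r212.
have [ew ev eh ef] := equi tT xr yr xy_rho.
have r2eta : r2 <= 6 * eta by lra.
pose B := w t x - v t y + gam * (v t y - A) ^+ 2
  - (2 * eps)^-1 * dotv (x - y) (x - y).
have chiX : 0 <= chi (k0 + k0) x + chi (k0 + k0) y.
  by rewrite addr_ge0// exprn_ge0// (le_trans ler01 (sq1_ge1 _)).
have dB : expR (mu * t) * B - del * (chi (k0 + k0) x + chi (k0 + k0) y) - F t >= kap.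
  exact: dkap.
have Ft0 := F0 tT.
have X0 := mulr_ge0 (ltW del0) chiX.
have aB : kap <= expR (mu * t) * B by move: dB Ft0 X0; lra.
have B0 : 0 <= B by rewrite -(pmulr_rge0 _ a0); apply: le_trans aB; exact: ltW.
have aM : expR (mu * t) <= M by rewrite ler_expR ler_wpM2l.
have a1 : 1 <= expR (mu * t).
  by apply: le_trans (expR_ge1Dx _); rewrite lerDl mulr_ge0.
have ev2 := vA y yr.
have [tltT|Tlet] := ltP t T; last first.
  have tE : t = T by apply: le_anti; rewrite tleT Tlet.
  (* The terminal gap is at most [h1 x - h2 y], split at [h1 y] into an equicontinuity error [eta]
     and a convergence error [zeta]. *)
  have MB : M * B <= M * (eta + zeta + 4 * gam * A ^+ 2).
    rewrite ler_wpM2l ?expR_ge0// /B r2E.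
    have r20 : 0 <= r2 by rewrite mulr_ge0 ?sqr_ge0// invr_ge0 ltW.
    have gV : gam * (v t y - A) ^+ 2 <= gam * (4 * A ^+ 2).
      rewrite ler_wpM2l ?(ltW gam0)//.
      move: ev2; rewrite ler_norml => /andP[v1 v2].
      have := mulr_ge0 (_ : 0 <= v t y + A) (_ : 0 <= 3 * A - v t y).
      by rewrite -lerBlDr sub0r v1 subr_ge0 => /(_ isT); move: (v t y) v1 v2 => V; nra.
    have := wT x; have := vT y; have := diffh yr; have := le_trans (ler_norm _) eh.
    rewrite -tE; lra.
  have := le_trans aB (ler_wpM2r B0 aM); have := terminal; lra.
have tT' : 0 <= t < T by rewrite t00.
have k1 : `|f1 t x (v t y) 0| <= Kf.
  apply: le_trans KfE; have := lip_f lip1 x (v t y) 0 0 0 tT.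
  rewrite subrr frob0 addr0 subr0 => l1.
  have := ler_normD (f1 t x (v t y) 0 - f1 t x 0 0) (f1 t x 0 0); rewrite subrK.
  have := le_trans (f1P x tT) (PA x xr); have := ler_wpM2l C0 ev2; lra.
have k2 : `|f2 t y (v t y) 0| <= Kf.
  apply: le_trans KfE; have := lip_f lip2 y (v t y) 0 0 0 tT.
  rewrite subrr frob0 addr0 subr0 => l1.
  have := ler_normD (f2 t y (v t y) 0 - f2 t y 0 0) (f2 t y 0 0); rewrite subrK.
  have := le_trans (f2P y tT) (PA y yr); have := ler_wpM2l C0 ev2; lra.
have Kf0 : 0 <= Kf by apply: le_trans KfE; rewrite addr_ge0// mulr_ge0.
have [Db Ds Df] := diffD tT yr.
have Ht : expR (mu * t) * (dt T w t x - (1 - 2 * gam * (v t y - A)) * dt T v t y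
    + mu * B) <= - G t.
  apply: (time_max_condition (q := (2 * eps)^-1 * dotv (x - y) (x - y))
    (X := del * (chi (k0 + k0) x + chi (k0 + k0) y)) wC vC tT' mu0 B0 _ (FG tT')).
  move=> s /andP[ts sT]; apply: (dmax s x y).
  by rewrite sT (le_trans t00 (ltW ts)).
have HX : del * (chi (k0 + k0) x + chi (k0 + k0) y) <= expR (mu * t) * B.
  by move: dB Ft0 kap0; lra.
have Hsp x' y' : expR (mu * t) * (w t x' - v t y' + gam * (v t y' - A) ^+ 2
        - (2 * eps)^-1 * dotv (x' - y') (x' - y')) - del * (chi (k0 + k0) x' +
          chi (k0 + k0) y')
     <= expR (mu * t) * B - del * (chi (k0 + k0) x + chi (k0 + k0) y).
  by have := dmax t x' y' tT; rewrite /doubled lerD2r.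
have HDf z : frob z <= N -> f1 t x (v t y) z - f2 t y (v t y) z <= eta + D t.
  move=> zN; have := le_trans (ler_norm _) (ef _ _ ev2 zN); have := Df _ _ ev2 zN; lra.
have concl := doubling_inequality C0 lip1 lip2 wC vC tT' a1 (ltW del0) gam0 eps01
  A0 Kf0 (D0 t) eta0 (wpde _ _ tT') (vpde _ _ tT') Hsp Ht HX muC ev2 k1 k2 NK N1
  Db Ds HDf (le_trans (ltW xy_rho) rho1).
have := DG tT'; rewrite ltNge => /negP; apply; apply: (le_trans concl).
have ie0 : 0 <= eps^-1 by rewrite invr_ge0 ltW.
have CC0 : 0 <= 3 / 2 * C + 2 * C ^+ 2 by rewrite addr_ge0 ?mulr_ge0 ?sqr_ge0//
  divr_ge0.
have gterm : 0 <= gam * (4 * C * A ^+ 2 + 4 * A * Kf + 32 * A ^+ 2 * C ^+ 2).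
  by rewrite mulr_ge0 ?(ltW gam0)// !addr_ge0 ?mulr_ge0 ?sqr_ge0 ?mulr_ge0.
have Dterm : 0 <= eps^-1 * ((2 + C) * D t + D t ^+ 2).
  by rewrite mulr_ge0// addr_ge0 ?sqr_ge0// mulr_ge0 ?addr_ge0.
apply: (ler_pM (expR_ge0 _) _ aM).
  by rewrite !addr_ge0// mulr_ge0// /r2 mulr_ge0// sqr_ge0.
by rewrite lerD2r lerD2r lerD2r ler_wpM2l.
Qed.

End DoublingContradiction.

(** * Closeness of the two families of coefficients outside small sets of times *)

Section UniformCoefficients.
Variable R : realType.
Local Notation mu := (@lebesgue_measure R).

Lemma frob_le_norm (m n : nat) (A : 'M[R]_(m, n)) :
  frob A <= (m * n)%:R * `|A|.
Proof.
apply: (le_trans (frob_le_sum A)).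
have entry i j : `|A i j| <= `|A|.
  by rewrite [leRHS]/Num.norm/= mx_normrE; apply/bigmax_geP; right; exists (i, j).
apply: (@le_trans _ _ (\sum_(i < m) \sum_(j < n) `|A|)).
  by apply: ler_sum => i _; apply: ler_sum => j _; exact: entry.
by rewrite !sumr_const !card_ord -mulrnA mulr_natl mulnC.
Qed.

Lemma frob_cvg0 (m n : nat) (A B : nat -> 'M[R]_(m, n)) (L : 'M[R]_(m, n)) :
  A k @[k --> \oo] --> L -> B k @[k --> \oo] --> L ->
  frob (A k - B k) @[k --> \oo] --> (0 : R).
Proof.
move=> AL BL.
have H : (m * n)%:R * `|A k - B k| @[k --> \oo] --> (m * n)%:R * `|L - L|.
  by apply: cvgM; [exact: cvg_cst|apply: cvg_norm; exact: cvgB].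
rewrite subrr normr0 mulr0 in H.
apply: (squeeze_cvgr _ (cvg_cst 0) H); near=> k.
by rewrite frob_ge0 frob_le_norm.
Unshelve. all: by end_near. Qed.

Lemma frob_lip (m n : nat) (A B : 'M[R]_(m, n)) : `|frob A - frob B| <= frob (A - B).
Proof.
have h1 := frobD (A - B) B; have h2 := frobD (B - A) A.
rewrite !subrK in h1 h2; rewrite frobC in h2.
by rewrite ler_norml; apply/andP; split; lra.
Qed.

Variables (d : nat) (T : R).
Local Notation E := 'cV[R]_d.

Lemma closed_strip : closed (@strip R d T).
Proof.
have -> : strip T = (fst : R * E -> R) @^-1` `[0, T].
  by apply/seteqP; split=> p; rewrite /strip /= in_itv.
apply: closed_comp; last exact: interval_closed.
by move=> p _; exact: cvg_fst.
Qed.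

Lemma closed_strip_gen : closed (@strip_gen R d T).
Proof.
have -> : strip_gen T = (fun p : R * E * R * E => p.1.1.1) @^-1` `[0, T].
  by apply/seteqP; split=> p; rewrite /strip_gen /= in_itv.
apply: closed_comp; last exact: interval_closed.
move=> p _.
have c1 : fst z @[z --> nbhs p] --> p.1 by exact: cvg_fst.
have c2 : fst z @[z --> nbhs p.1] --> p.1.1 by exact: cvg_fst.
have c3 : fst z @[z --> nbhs p.1.1] --> p.1.1.1 by exact: cvg_fst.
exact: (cvg_comp _ _ (cvg_comp _ _ c1 c2) c3).
Qed.

Lemma matrix_uniform_outside (m n : nat) (A B : nat -> R -> E -> 'M[R]_(m, n))
    (L : R -> E -> 'M[R]_(m, n)) (C zeta eta : R) (K : set E) :
  (forall k, borel_fun (strip T) (fun p : R * E => A k p.1 p.2)) ->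
  (forall k, borel_fun (strip T) (fun p : R * E => B k p.1 p.2)) ->
  (forall k t x y, 0 <= t <= T -> frob (A k t x - A k t y) <= C * frob (x - y)) ->
  (forall k t x y, 0 <= t <= T -> frob (B k t x - B k t y) <= C * frob (x - y)) ->
  (forall t x, 0 <= t <= T -> A k t x @[k --> \oo] --> L t x) ->
  (forall t x, 0 <= t <= T -> B k t x @[k --> \oo] --> L t x) ->
  compact K -> 0 < zeta -> 0 < eta ->
  exists O : set R, [/\ open O, (mu O < eta%:E)%E &
    \forall k \near \oo, forall t x, 0 <= t <= T -> ~ O t -> K x ->
      frob (A k t x - B k t x) <= zeta].
Proof.
move=> Ab Bb Alip Blip AL BL cK zeta0 eta0.
pose g k t x := frob (A k t x - B k t x).
have [|||U [oU Ueta Uk]] := @small_open_uniform R T E K g zeta eta cK _ _ _ zeta0 eta0.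
- move=> k p _; rewrite /g /frob.
  have msec (M : nat -> R -> E -> 'M[R]_(m, n)) i j :
      (forall k, borel_fun (strip T) (fun p : R * E => M k p.1 p.2)) ->
      measurable_fun `[0, T] (fun t => M k t p i j).
    move=> Mb; apply: (@borel_section R (R * E)%type 'M[R]_(m, n) (strip T)
      (fun p => M k p.1 p.2) (fun t => (t, p)) (fun N => N i j)) => //.
    + exact: closed_strip.
    + move=> t; have c1 : (s : R) @[s --> nbhs t] --> t by exact: cvg_id.
      have c2 : p @[_ --> nbhs t] --> p by exact: cvg_cst.
      exact: cvg_pair c1 c2.
    + exact: coord_continuous.
  have msqrt : measurable_fun setT (@Num.sqrt R).
    by apply: continuous_measurable_fun; exact: sqrt_continuous.
  apply: (@measurableT_comp _ _ _ _ _ _ (@Num.sqrt R) _ (fun t => \sum_i \sum_j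
    (A k t p - B k t p) i j ^+ 2)) => //.
  apply: measurable_sum => i; apply: measurable_sum => j.
  apply: measurable_funX.
  apply: (eq_measurable_fun (fun t => A k t p i j - B k t p i j)).
    by move=> t _; rewrite !mxE.
  by apply: measurable_funB; exact: msec.
- move=> e e0.
  (* The common Lipschitz constant supplies the equicontinuity: 2 for the two families, [d * 1] to
     pass from the Frobenius to the max norm, and 1 to keep [c] positive. *)
  pose c := (2 * `|C| * (d * 1)%:R + 1).
  have c0 : 0 < c by rewrite ltr_pwDr// !mulr_ge0.
  exists (e / c); first exact: divr_gt0.
  move=> k t x y tT _ _ xy; apply: (le_lt_trans (frob_lip _ _)).
  have -> : A k t x - B k t x - (A k t y - B k t y)
      = (A k t x - A k t y) - (B k t x - B k t y) by rewrite !opprD !opprK addrACA.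
  apply: (le_lt_trans (frobB _ _)).
  have a := Alip k t x y tT; have b := Blip k t x y tT.
  have f0 := frob_ge0 (x - y); have fn := frob_le_norm (x - y).
  have Cf := ler_wpM2r f0 (ler_norm C).
  have Cn := ler_wpM2l (normr_ge0 C) fn.
  have n0 := normr_ge0 (x - y).
  rewrite ltr_pdivlMr// in xy; apply: le_lt_trans xy.
  rewrite /c; move: a b Cf Cn n0; lra.
- by move=> t p tT _; apply: frob_cvg0; [exact: AL|exact: BL].
exists U; split=> //; move: Uk; apply: filterS => k kP t x tT nU Kx.
by have := kP t x tT nU Kx; rewrite ger0_norm ?frob_ge0.
Qed.

Lemma generator_uniform_outside (f1 f2 : nat -> R -> E -> R -> E -> R)
    (f : R -> E -> R -> E -> R) (zeta eta : R) (K : set (E * R * E)) :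
  (forall k, borel_fun (strip_gen T) (fun p : R * E * R * E => f1 k p.1.1.1
    p.1.1.2 p.1.2 p.2)) ->
  (forall k, borel_fun (strip_gen T) (fun p : R * E * R * E => f2 k p.1.1.1
    p.1.1.2 p.1.2 p.2)) ->
  equicontinuous_on_compacts [set i : nat * R | 0 <= i.2 <= T]
        (fun i (p : E * R * E) => f1 i.1 i.2 p.1.1 p.1.2 p.2) ->
  equicontinuous_on_compacts [set i : nat * R | 0 <= i.2 <= T]
        (fun i (p : E * R * E) => f2 i.1 i.2 p.1.1 p.1.2 p.2) ->
  (forall t x y z, 0 <= t <= T -> f1 k t x y z @[k --> \oo] --> f t x y z) ->
  (forall t x y z, 0 <= t <= T -> f2 k t x y z @[k --> \oo] --> f t x y z) ->
  compact K -> 0 < zeta -> 0 < eta ->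
  exists O : set R, [/\ open O, (mu O < eta%:E)%E &
    \forall k \near \oo, forall t x y z, 0 <= t <= T -> ~ O t -> K (x, y, z) ->
      `|f1 k t x y z - f2 k t x y z| <= zeta].
Proof.
move=> b1 b2 e1 e2 l1 l2 cK zeta0 eta0.
pose g k t (p : E * R * E) := f1 k t p.1.1 p.1.2 p.2 - f2 k t p.1.1 p.1.2 p.2.
have [|||U [oU Ueta Uk]] := @small_open_uniform R T _ K g zeta eta cK _ _ _ zeta0 eta0.
- move=> k [[x y] z] _; rewrite /g/=.
  have msec (F : nat -> R -> E -> R -> E -> R) :
      (forall k, borel_fun (strip_gen T) (fun p : R * E * R * E => F k p.1.1.1
        p.1.1.2 p.1.2 p.2)) ->
      measurable_fun `[0, T] (fun t => F k t x y z).
    move=> Fb; apply: (@borel_section R (R * E * R * E)%type R (strip_gen T)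
      (fun p => F k p.1.1.1 p.1.1.2 p.1.2 p.2) (fun t => (t, x, y, z)) id) => //.
    + exact: closed_strip_gen.
    + move=> t; have c1 : (s : R) @[s --> nbhs t] --> t by exact: cvg_id.
      have c2 : x @[_ --> nbhs t] --> x by exact: cvg_cst.
      have c3 : y @[_ --> nbhs t] --> y by exact: cvg_cst.
      have c4 : z @[_ --> nbhs t] --> z by exact: cvg_cst.
      exact: (cvg_pair (cvg_pair (cvg_pair c1 c2) c3) c4).
    + by move=> ?; exact: cvg_id.
  exact: (measurable_funB (msec f1 b1) (msec f2 b2)).
- move=> e e0; have e20 : 0 < e / 2 by rewrite divr_gt0.
  have [d1 d10 d1P] := e1 K cK _ e20; have [d2 d20 d2P] := e2 K cK _ e20.
  exists (Num.min d1 d2); first by rewrite lt_min d10.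
  move=> k t p q tT Kp Kq; rewrite lt_min => /andP[pq1 pq2].
  have h1 := d1P (k, t) p q tT Kp Kq pq1; have h2 := d2P (k, t) p q tT Kp Kq pq2.
  rewrite /g /= in h1 h2 *.
  rewrite [X in `|X|](_ : _ = (f1 k t p.1.1 p.1.2 p.2 - f1 k t q.1.1 q.1.2 q.2)
    - (f2 k t p.1.1 p.1.2 p.2 - f2 k t q.1.1 q.1.2 q.2)); last by ring.
  by rewrite (le_lt_trans (ler_normB _ _))// [e]splitr ltrD.
- move=> t p tT _; rewrite /g -(subrr (f t p.1.1 p.1.2 p.2)).
  by apply: cvgB; [exact: l1|exact: l2].
exists U; split=> //; move: Uk; apply: filterS => k kP t x y z tT nU Kx.
exact: kP nU Kx.
Qed.

(** The result for time-dependent functions is applied to functions constant in time on [0,1]: an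
    exceptional set of measure below 1/2 misses some time, and any such time gives the claim. *)
Lemma uniform_on_compact (h1 h2 : nat -> E -> R) (h : E -> R) (zeta : R) (K : set E) :
  equicontinuous_on_compacts [set: nat] h1 ->
  equicontinuous_on_compacts [set: nat] h2 ->
  (forall x, h1 k x @[k --> \oo] --> h x) ->
  (forall x, h2 k x @[k --> \oo] --> h x) ->
  compact K -> 0 < zeta ->
  \forall k \near \oo, forall x, K x -> `|h1 k x - h2 k x| <= zeta.
Proof.
move=> e1 e2 l1 l2 cK zeta0.
pose g k (t : R) x := h1 k x - h2 k x.
have half : (0 : R) < 1 / 2 by rewrite divr_gt0.
have [|||U [oU Ueta Uk]] := @small_open_uniform R 1 E K g zeta (1 / 2) cK _ _ _
  zeta0 half.
- by move=> k p _; exact: measurable_cst.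
- move=> e e0; have e20 : 0 < e / 2 by rewrite divr_gt0.
  have [d1 d10 d1P] := e1 K cK _ e20; have [d2 d20 d2P] := e2 K cK _ e20.
  exists (Num.min d1 d2); first by rewrite lt_min d10.
  move=> k t p q tT Kp Kq; rewrite lt_min => /andP[pq1 pq2].
  have hh1 := d1P k p q I Kp Kq pq1; have hh2 := d2P k p q I Kp Kq pq2.
  rewrite /g [X in `|X|](_ : _ = (h1 k p - h1 k q) - (h2 k p - h2 k q)); last by ring.
  by rewrite (le_lt_trans (ler_normB _ _))// [e]splitr ltrD.
- move=> t p tT _; rewrite /g -(subrr (h p)).
  by apply: cvgB; [exact: l1|exact: l2].
have [t [tT nU]] : exists t, 0 <= t <= 1 /\ ~ U t.
  apply: contrapT => H.
  have : (mu `[0%R, 1%R] <= mu U)%E.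
    apply: (le_measure mu); rewrite ?inE; [exact: measurable_itv|exact:
      open_measurable|].
    by move=> t /=; rewrite in_itv/= => tT; apply: contrapT => nU; apply: H; exists t.
  rewrite lebesgue_measure_itv/= lte_fin ltr01 => /le_lt_trans/(_ Ueta).
  by rewrite -EFinB lte_fin subr0; lra.
by move: Uk; apply: filterS => k kP x Kx; exact: kP nU Kx.
Qed.

End UniformCoefficients.

(** * Normalisation of the growth bounds and choice of the parameters *)

Lemma lipschitz_coefs_le (R : realType) (d : nat) (T C C' : R)
    (b : R -> 'cV[R]_d -> 'cV[R]_d) (s : R -> 'cV[R]_d -> 'M[R]_d)
    (f : R -> 'cV[R]_d -> R -> 'cV[R]_d -> R) :
  C <= C' -> lipschitz_coefs T C b s f -> lipschitz_coefs T C' b s f.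
Proof.
move=> CC [h1 h2 h3]; split.
- by move=> t x x' tT; apply: (le_trans (h1 t x x' tT)); rewrite ler_wpM2r// frob_ge0.
- move=> t x y y' z z' tT; apply: (le_trans (h2 t x y y' z z' tT)).
  by rewrite ler_wpM2r// addr_ge0// frob_ge0.
- by move=> t tT; exact: le_trans (h3 t tT) CC.
Qed.

(** Real exponents are traded for integer powers of the smooth weight [sq1], whose jets are
    available. *)
Lemma powR_le_sq1 (R : realType) (d : nat) (x : 'cV[R]_d) (m : R) (k : nat) :
  0 <= m <= k%:R -> 1 + frob x `^ m <= 2 * sq1 x ^+ k.
Proof.
move=> /andP[m0 mk]; have s1 := sq1_ge1 x; have s0 := le_trans ler01 s1.
have fs : frob x <= sq1 x.
  by rewrite /sq1 dotvv; have := sqr_ge0 (frob x - 1); have := frob_ge0 x; nra.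
have e1 : frob x `^ m <= sq1 x `^ m by rewrite ge0_ler_powR ?nnegrE ?frob_ge0.
have e2 : sq1 x `^ m <= sq1 x `^ k%:R by rewrite ler_powR.
rewrite powR_mulrn// in e2.
have e3 : 1 <= sq1 x ^+ k by rewrite exprn_ege1.
by lra.
Qed.

(** A linear function of slope -tau plus [K1] times the tail measure of [O]. The second part never
    increases, so the slopes add, and [K1] enters the size of [F] only multiplied by the measure
    bound [eta]. *)
Lemma open_penalty (R : realType) (T tau K1 eta : R) (O : set R) :
  open O -> (lebesgue_measure O < eta%:E)%E -> 0 <= tau -> 0 <= K1 ->
  exists F : R -> R, [/\ forall t, 0 <= t <= T -> 0 <= F t <= tau * T + K1 * eta,
    continuous F &
    forall t, \forall s \near t^'+,
      F s <= F t - (tau + (if `[< O t >] then K1 else 0)) * (s - t)].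
Proof.
move=> oU Ueta tau0 K10; have [H [H0 Hmono HO]] := open_tail_measure oU Ueta.
have H1 t s : t <= s -> 0 <= H t - H s <= s - t.
  by move=> /Hmono /andP[h1 h2]; rewrite subr_ge0 h1 lerBlDl.
have Hc : continuous H.
  move=> t; apply/cvgrPdist_lt => e e0; apply: filterS (nbhsx_ballx t e e0) => s.
  rewrite -ball_normE/=; apply: le_lt_trans.
  have [ts|st] := leP t s.
    have /andP[h1 h2] := H1 _ _ ts; rewrite ger0_norm// (le_trans h2)//.
    by rewrite distrC ler_norm.
  have /andP[h1 h2] := H1 _ _ (ltW st); rewrite distrC ger0_norm// (le_trans h2)//.
  exact: ler_norm.
exists (fun t => tau * (T - t) + K1 * H t); split.
- move=> t /andP[t0 tT]; have /andP[h1 h2] := H0 t; apply/andP; split.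
    by rewrite addr_ge0 ?mulr_ge0 ?subr_ge0.
  by rewrite lerD// ler_wpM2l// gerBl.
- move=> t; apply: cvgD; apply: cvgM; [exact: cvg_cst| |exact: cvg_cst|exact: Hc].
  by apply: cvgB; [exact: cvg_cst|exact: cvg_id].
move=> t; case: asboolP => Ot.
  apply: filterS (HO _ Ot) => s Hs; rewrite Hs.
  by rewrite le_eqVlt; apply/orP; left; apply/eqP; ring.
apply: filterS (nbhs_right_ge t) => s ts; have /andP[h1 _] := Hmono _ _ ts.
by have := ler_wpM2l K10 h1; lra.
Qed.

(** The number [B] in the proof dominates every quantity that [gam] will multiply, so the single
    choice [gam = sg / (M * B)] serves all of them. [N] depends on [gam], whereas [eta] depends only
    on [C], [M] and [sg]. *)
Lemma choose_gamma (R : realType) (C M A S sg : R) : 0 <= C -> 1 <= M -> 1 <= A ->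
  0 <= S -> 0 < sg -> sg <= 1 ->
  exists gam N eta : R, [/\ 0 < gam, gam <= 1, gam * A ^+ 2 <= 1 &
    4 * (A + C * A + C) <= gam * N /\ 1 <= N] /\
    [/\ 0 < eta, M * ((3 / 2 * C + 2 * C ^+ 2) * (6 * eta) + eta) <= sg,
      M * (gam * S) <= sg & M * (4 * gam * A ^+ 2) <= sg].
Proof.
move=> C0 M1 A1 S0 sg0 sg1.
have A20 : 0 <= A ^+ 2 := sqr_ge0 A.
pose B := 1 + 4 * A ^+ 2 + S.
have B1 : 1 <= B by rewrite /B; lra.
have MB1 : 1 <= M * B by rewrite -[1]mulr1 ler_pM.
have MB0 : 0 < M * B := lt_le_trans ltr01 MB1.
have M0 : 0 < M := lt_le_trans ltr01 M1.
pose gam := sg / (M * B).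
have gam0 : 0 < gam by rewrite divr_gt0.
have gamMB : gam * (M * B) = sg by rewrite divfK// gt_eqF.
have small X : 0 <= X -> X <= B -> M * (gam * X) <= sg.
  by move=> X0 XB; rewrite -gamMB mulrCA ler_wpM2l ?(ltW gam0)// ler_wpM2l// ltW.
have small1 X : 0 <= X -> X <= B -> gam * X <= 1.
  move=> X0 XB; apply: le_trans sg1; apply: le_trans (small X X0 XB).
  by rewrite ler_peMl// mulr_ge0// ltW.
pose N := 4 * (A + C * A + C) / gam + 1.
have AC : 0 <= 4 * (A + C * A + C).
  by rewrite mulr_ge0// !addr_ge0// ?mulr_ge0//; lra.
have N1 : 1 <= N by rewrite lerDr divr_ge0// ltW.
pose c := (3 / 2 * C + 2 * C ^+ 2) * 6 + 1.
have c0 : 0 < c by rewrite ltr_pwDr// mulr_ge0// addr_ge0 ?mulr_ge0 ?sqr_ge0// divr_ge0.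
exists gam, N, (sg / (M * c)); split; split.
- by [].
- by rewrite -[gam]mulr1; apply: small1.
- by apply: small1 => //; rewrite /B; lra.
- split=> //; have -> : gam * N = 4 * (A + C * A + C) + gam.
    by rewrite /N; field; rewrite gt_eqF.
  by rewrite lerDl ltW.
- by rewrite divr_gt0// mulr_gt0.
- rewrite [X in X <= _](_ : _ = sg)//.
  rewrite (_ : _ + _ = c * (sg / (M * c))); last by rewrite /c; ring.
  by field; rewrite !gt_eqF.
- by apply: small => //; rewrite /B; lra.
- rewrite [X in M * X](_ : _ = gam * (4 * A ^+ 2)); last by ring.
  by apply: small; rewrite /B; lra.
Qed.

(** The 13 in [eps] makes the bound by [12 * A * eps] strict. [zeta] carries a factor [eps] to
    offset the 1/eps in front of the coefficient gap, and [3 + C] covers (2 + C) zeta + zeta^2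
    because zeta <= 1. *)
Lemma choose_eps (R : realType) (C M A rho sg : R) : 0 <= C -> 1 <= M -> 1 <= A ->
  0 < rho -> rho <= 1 -> 0 < sg -> sg <= 1 ->
  exists eps zeta : R, [/\ 0 < eps <= 1, 12 * A * eps < rho ^+ 2, 0 < zeta,
    M * zeta <= sg & M * (eps^-1 * ((2 + C) * zeta + zeta ^+ 2)) <= sg].
Proof.
move=> C0 M1 A1 rho0 rho1 sg0 sg1.
have M0 : 0 < M := lt_le_trans ltr01 M1.
have A0 : 0 < A := lt_le_trans ltr01 A1.
have rho2 : 0 < rho ^+ 2 by rewrite exprn_gt0.
have rho21 : rho ^+ 2 <= 1 by rewrite expr_le1// ltW.
pose eps := rho ^+ 2 / (13 * A).
have eps0 : 0 < eps by rewrite divr_gt0// mulr_gt0.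
have epsE : eps * (13 * A) = rho ^+ 2 by rewrite divfK// gt_eqF// mulr_gt0.
have epsA : 0 < eps * A by rewrite mulr_gt0.
have epsA1 : eps <= eps * A by rewrite ler_peMr// ltW.
have eps1 : eps <= 1 by lra.
have C3 : 0 < 3 + C by lra.
pose zeta := sg * eps / (M * (3 + C)).
have MC : 1 <= M * (3 + C) by rewrite -[1]mulr1 ler_pM//; lra.
have MC0 : 0 < M * (3 + C) := lt_le_trans ltr01 MC.
have zeta0 : 0 < zeta by rewrite divr_gt0// mulr_gt0.
have zetaE : zeta * (M * (3 + C)) = sg * eps by rewrite divfK// gt_eqF.
have se : sg * eps <= sg by rewrite ler_piMr// ltW.
have zM : M * zeta * (3 + C) = sg * eps by rewrite -zetaE; ring.
have Mz0 : 0 < M * zeta by rewrite mulr_gt0.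
have Mz : M * zeta <= sg.
  by have := mulr_ge0 (ltW Mz0) C0; lra.
have z1 : zeta <= 1.
  apply: le_trans sg1; apply: le_trans Mz; by rewrite ler_peMl// ltW.
exists eps, zeta; split=> //; first by rewrite eps0.
- by rewrite -epsE; lra.
- rewrite mulrCA ler_pdivrMl// [leRHS]mulrC -zM.
  have zz : zeta ^+ 2 <= zeta by rewrite expr2 ler_piMr// ltW.
  have Mzz := ler_wpM2l (ltW M0) zz; lra.
Qed.

Lemma terminal_arith (R : realType) (M c eta zeta X sg kap : R) :
  0 <= M * (c * (6 * eta)) -> M * (c * (6 * eta) + eta) <= sg -> M * zeta <= sg ->
  M * X <= sg -> sg <= kap / 4 -> 0 < kap -> M * (eta + zeta + X) < kap.
Proof. by move=> *; lra. Qed.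

Lemma error_arith (R : realType) (M c eta e X sg tau K : R) :
  M * (c * (6 * eta) + eta) <= sg -> M * X <= sg -> M * e <= sg + K ->
  sg <= tau / 8 -> 0 < tau -> M * (c * (6 * eta) + e + eta + X) < tau + K.
Proof. by move=> *; lra. Qed.

Lemma generator_bound_arith (R : realType) (F F0 C a z A N p : R) :
  0 <= C -> `|F - F0| <= C * (`|a| + z) -> `|F0| <= p -> p <= A -> `|a| <= A -> z
    <= N ->
  `|F| <= A + C * A + C * N.
Proof.
move=> C0 h1 h2 h3 aA zN; have h4 := ler_wpM2l C0 (lerD aA zN).
by have := ler_normD (F - F0) F0; rewrite subrK => h5; lra.
Qed.

Lemma initial_arith (R : realType) (a kap B F tauT K e : R) :
  1 <= a -> 0 <= kap -> 2 * kap <= B -> F <= kap / 4 + K * e -> K * e <= kap / 4 ->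
  kap <= a * B - kap / 2 - F.
Proof.
move=> a1 kap0 kB h1 h2.
by have := ler_pM ler01 (mulr_ge0 (ler0n _ 2) kap0) a1 kB; rewrite mul1r => h3; lra.
Qed.

(** * The comparison principle *)

Section Comparison.
Variables (R : realType) (d : nat) (T : R).
Local Notation E := 'cV[R]_d.
Hypothesis T0 : 0 < T.
Variables (b : R -> E -> E) (sigma : R -> E -> 'M[R]_d).
Variables (f : R -> E -> R -> E -> R) (h : E -> R) (ucheck uhat : R -> E -> R).

Lemma sq1_le_ball (x : E) (r : R) : 1 <= r -> sq1 x <= r -> frob x <= r.
Proof.
move=> r1 xr; rewrite -ler_sqr ?nnegrE ?frob_ge0 ?(le_trans ler01 r1)// -dotvv.
by have := ler_wpM2l (le_trans ler01 r1) r1; move: xr; rewrite /sq1 expr2; lra.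
Qed.

Lemma growth_from_powR (C m : R) (k : nat) (x : E) (p q s : R) :
  0 <= C -> 0 <= m <= k%:R -> `|p| + `|q| + `|s| <= C * (1 + frob x `^ m) ->
  `|p| <= 2 * C * sq1 x ^+ k /\ `|s| <= 2 * C * sq1 x ^+ k.
Proof.
move=> C0 mk H; have := le_trans H (ler_wpM2l C0 (powR_le_sq1 x mk)).
have := normr_ge0 p; have := normr_ge0 q; have := normr_ge0 s.
by split; lra.
Qed.

(** The assumed gap is [4 * kap]. For large n more than [2 * kap] of it remains; at (t0,x0,x0) the
    weight costs [kap / 2] and [F] at most [kap / 2], so the doubled function reaches [kap], which
    [doubling_contradiction] excludes. *)
Lemma comparison : sv_subsolution T b sigma f h ucheck ->
  sv_supersolution T b sigma f h uhat ->
  forall t x, 0 <= t <= T -> ucheck t x <= uhat t x.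
Proof.
move=> [un [hn [fn [bn [sn [bor1 [[C1 [m1 [C10 m10 lip1 gr1]]] [[eu1 eh1 ef1]
  [cl1 [cv1 ch1]]]]]]]]]].
move=> [vn [kn [gn [cn [rn [bor2 [[C2 [m2 [C20 m20 lip2 gr2]]] [[eu2 eh2 ef2]
  [cl2 [cv2 ch2]]]]]]]]]].
move=> t0 x0 t0T; rewrite leNgt; apply/negP => gap.
pose C := C1 + C2.
have C0 : 0 <= C by rewrite addr_ge0// ltW.
have C1C : C1 <= C by rewrite lerDl ltW.
have C2C : C2 <= C by rewrite lerDr ltW.
have l1 n := lipschitz_coefs_le C1C (lip1 n).
have l2 n := lipschitz_coefs_le C2C (lip2 n).
pose k := (Num.truncn (m1 + m2)).+1.
have mk : m1 + m2 <= k%:R by apply/ltW; exact: truncnS_gt.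
have mk1 : 0 <= m1 <= k%:R by rewrite ltW//=; lra.
have mk2 : 0 <= m2 <= k%:R by rewrite ltW//=; lra.
(* The 2 comes from [powR_le_sq1]; the 1 ensures [P >= 1] and later [A >= 1]. *)
pose P := 2 * C + 1.
have P1 : 1 <= P by rewrite lerDr mulr_ge0.
have P0 : 0 <= P := le_trans ler01 P1.
have CP D (x : E) : D <= C -> 2 * D * sq1 x ^+ k <= P * sq1 x ^+ k.
  move=> DC; rewrite ler_wpM2r ?exprn_ge0 ?(le_trans ler01 (sq1_ge1 x))//.
  by rewrite /P; lra.
have g1 n t x : 0 <= t <= T -> `|un n t x| <= P * sq1 x ^+ k /\ `|fn n t x 0 0|
  <= P * sq1 x ^+ k.
  move=> tT; have [p q] := growth_from_powR (ltW C10) mk1 (gr1 n t x tT).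
  by split; [apply: le_trans p _|apply: le_trans q _]; exact: CP.
have g2 n t x : 0 <= t <= T -> `|vn n t x| <= P * sq1 x ^+ k /\ `|gn n t x 0 0|
  <= P * sq1 x ^+ k.
  move=> tT; have [p q] := growth_from_powR (ltW C20) mk2 (gr2 n t x tT).
  by split; [apply: le_trans p _|apply: le_trans q _]; exact: CP.
pose kap := (ucheck t0 x0 - uhat t0 x0) / 4.
have kap0 : 0 < kap by rewrite divr_gt0// subr_gt0.
pose tau := kap / (4 * T).
have tau0 : 0 < tau by rewrite divr_gt0// mulr_gt0.
have tauT : tau * T = kap / 4 by rewrite /tau; field; rewrite gt_eqF.
pose Cg := growth_cst (k + k) C.
have Cg0 : 0 <= Cg.
  apply: mulr_ge0; last by rewrite addr_ge0// sqr_ge0.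
  by apply: mulr_ge0 => //; rewrite addr_ge0// mulr_ge0.
pose mu := C + (2 + C) * Cg.
have mu0 : 0 <= mu by rewrite addr_ge0// mulr_ge0// addr_ge0.
pose M := expR (mu * T).
have M1 : 1 <= M.
  by apply: le_trans (expR_ge1Dx _); rewrite lerDl mulr_ge0// ltW.
have chi0 : 0 < chi (k + k) x0.
  by rewrite exprn_gt0// (lt_le_trans ltr01 (sq1_ge1 x0)).
pose del := kap / (4 * chi (k + k) x0).
have del0 : 0 < del by rewrite divr_gt0// mulr_gt0.
have delE : del * (chi (k + k) x0 + chi (k + k) x0) = kap / 2.
  by rewrite /del; field; rewrite gt_eqF.
have MP0 : 0 <= M * (P + 2 * P ^+ 2 + 2).
  by rewrite mulr_ge0 ?(le_trans ler01 M1)// !addr_ge0// mulr_ge0// sqr_ge0.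
have [r r1 rP] := boundary_radius (k + k) MP0 del0.
pose A := P * r ^+ k.
have A1 : 1 <= A by rewrite -[1]mulr1 ler_pM// exprn_ege1.
have A0 : 0 <= A := le_trans ler01 A1.
pose Kf := A + C * A.
have Kf0 : 0 <= Kf by rewrite addr_ge0// mulr_ge0.
pose S := 4 * C * A ^+ 2 + 4 * A * Kf + 32 * A ^+ 2 * C ^+ 2.
have S0 : 0 <= S.
  apply: addr_ge0; first apply: addr_ge0.
  - by rewrite mulr_ge0 ?sqr_ge0// mulr_ge0.
  - by rewrite mulr_ge0// mulr_ge0.
  - by rewrite mulr_ge0 ?sqr_ge0// mulr_ge0 ?sqr_ge0.
(* Unit of error: at an interior time three errors of size [sg] add up to less than [tau], and at
   the terminal time three add up to less than [kap]. *)
pose sg := Num.min 1 (Num.min (tau / 8) (kap / 4)).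
have sg0 : 0 < sg.
  have t8 : 0 < tau / 8 by exact: divr_gt0.
  have k4 : 0 < kap / 4 by exact: divr_gt0.
  by rewrite !lt_min ltr01 t8 k4.
have [sg1 sgt sgk] : [/\ sg <= 1, sg <= tau / 8 & sg <= kap / 4].
  by rewrite /sg !ge_min !lexx ?orbT.
have [gam [N [eta [[gam0 gam1 gamA [NK N1]] [eta0 Meta MS MgA]]]]] :=
  choose_gamma C0 M1 A1 S0 sg0 sg1.
pose ball_ := [set x : E | `|x| <= r].
have inball (x : E) : sq1 x <= r -> ball_ x.
  by move=> xr; exact: le_trans (normr_le_frob x) (sq1_le_ball r1 xr).
have cball : compact ball_ by exact: compact_ball_cV.
pose Kset : set (E * R * E) := (ball_ `*` `[- A, A]%classic) `*` [set z | `|z| <= N].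
have cK : compact Kset.
  apply: compact_setX; last exact: compact_ball_cV.
  by apply: compact_setX; [exact: cball|exact: segment_compact].
have inK (x : E) a (z : E) : sq1 x <= r -> `|a| <= A -> frob z <= N -> Kset (x, a, z).
  move=> xr aA zN; split; [split|] => /=; first exact: inball.
    by rewrite in_itv/= -ler_norml.
  exact: le_trans (normr_le_frob z) zN.
have [d1 d10 d1P] := eu1 _ cball _ eta0.
have [d2 d20 d2P] := eu2 _ cball _ eta0.
have [d3 d30 d3P] := eh1 _ cball _ eta0.
have [d4 d40 d4P] := ef1 _ cK _ eta0.
(* Smallest of the moduli at [eta] of the subsolutions, the supersolutions, and the terminal data
   and generators of the subsolution family; the doubling compares [h] and [f] of that family at two
   points, and changes family only at a common point. *)
pose rho := Num.min 1 (Num.min (Num.min d1 d2) (Num.min d3 d4)).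
have rho0 : 0 < rho by rewrite !lt_min ltr01 d10 d20 d30 d40.
have rho1 : rho <= 1 by rewrite ge_min lexx.
have [eps [zeta [eps01 epsA zeta0 Mz Mze]]] := choose_eps C0 M1 A1 rho0 rho1 sg0 sg1.
have ie0 : 0 <= eps^-1 by rewrite invr_ge0; case/andP: eps01 => /ltW.
(* Crude bound for the coefficient gap at times in the exceptional set: linear growth for drift and
   diffusion, and the size of the generators for |y| <= A and |z| <= N. *)
pose Dmax := 2 * C * (1 + r) + 2 * (Kf + C * N).
have N0 : 0 <= N := le_trans ler01 N1.
have Dmax0 : 0 <= Dmax.
  have r0 : 0 <= r := le_trans ler01 r1.
  apply: addr_ge0.
    by apply: mulr_ge0; [exact: mulr_ge0|exact: addr_ge0].
  by apply: mulr_ge0 => //; apply: addr_ge0 => //; exact: mulr_ge0.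
pose K1 := M * (eps^-1 * ((2 + C) * Dmax + Dmax ^+ 2)).
have K10 : 0 <= K1.
  apply: mulr_ge0; first exact: le_trans ler01 M1.
  apply: mulr_ge0 => //; apply: addr_ge0; last exact: sqr_ge0.
  by apply: mulr_ge0 => //; exact: addr_ge0.
(* Makes the part [K1 * e0] of the bound on [F] at most [kap / 4]; the linear part [tau * T] is the
   other quarter. Each of the three exceptional sets, for drift, diffusion and generator, receives a
   third of [e0]. *)
pose e0 := kap / (4 * (K1 + 1)).
have K1p : 0 < K1 + 1 by rewrite ltr_wpDl.
have e00 : 0 < e0 by rewrite divr_gt0// mulr_gt0.
have e0E : K1 * e0 <= kap / 4.
  have -> : kap / 4 = (K1 + 1) * e0 by rewrite /e0; field; rewrite gt_eqF.
  by rewrite ler_wpM2r ?(ltW e00)// lerDl.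
have e3 : 0 < e0 / 3 by rewrite divr_gt0.
have [Ob [oOb mOb nOb]] := matrix_uniform_outside
  (fun n => borel_b (bor1 n).2) (fun n => borel_b (bor2 n).2)
  (fun n t x y tT => lip_b (l1 n) tT x y) (fun n t x y tT => lip_b (l2 n) tT x y)
  (fun t x tT => let: And4 _ H _ _ := cv1 t x tT in H)
  (fun t x tT => let: And4 _ H _ _ := cv2 t x tT in H) cball zeta0 e3.
have [Os [oOs mOs nOs]] := matrix_uniform_outside
  (fun n => borel_sigma (bor1 n).2) (fun n => borel_sigma (bor2 n).2)
  (fun n t x y tT => lip_sigma (l1 n) tT x y) (fun n t x y tT => lip_sigma (l2 n)
    tT x y)
  (fun t x tT => let: And4 _ _ H _ := cv1 t x tT in H)
  (fun t x tT => let: And4 _ _ H _ := cv2 t x tT in H) cball zeta0 e3.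
have [Of [oOf mOf nOf]] := generator_uniform_outside
  (fun n => borel_f (bor1 n).2) (fun n => borel_f (bor2 n).2) ef1 ef2
  (fun t x y z tT => let: And4 _ _ _ H := cv1 t x tT in H y z)
  (fun t x y z tT => let: And4 _ _ _ H := cv2 t x tT in H y z) cK zeta0 e3.
have nh := uniform_on_compact eh1 eh2 ch1 ch2 cball zeta0.
have nu : \forall n \near \oo, 2 * kap < un n t0 x0 - vn n t0 x0.
  have [H1 _ _ _] := cv1 t0 x0 t0T; have [H2 _ _ _] := cv2 t0 x0 t0T.
  have H : un n t0 x0 - vn n t0 x0 @[n --> \oo] --> ucheck t0 x0 - uhat t0 x0 by
    exact: cvgB.
  apply: (cvgr_gt (ucheck t0 x0 - uhat t0 x0) H).
  have -> : ucheck t0 x0 - uhat t0 x0 = 4 * kap by rewrite /kap mulrC divfK.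
  by rewrite ltr_pM2r// ltr_nat.
pose U := Ob `|` Os `|` Of.
have oU : open U by apply: openU => //; exact: openU.
have mU : (lebesgue_measure U < e0%:E)%E.
  have m1' := open_measurable oOb; have m2' := open_measurable oOs.
  have m3' := open_measurable oOf.
  apply: (le_lt_trans (measureU2 _ _ _)); [exact: measurableU|exact: m3'|].
  have -> : e0 = e0 / 3 + e0 / 3 + e0 / 3 by field.
  rewrite !EFinD; apply: lteD => //.
  by apply: (le_lt_trans (measureU2 _ _ _)) => //; exact: lteD.
have [F [F0 Fc FG]] := open_penalty T oU mU (ltW tau0) K10.
pose D t := if `[< U t >] then Dmax else zeta.
pose G t := tau + (if `[< U t >] then K1 else 0).
(* A single index satisfying all the asymptotic conditions; from here on n is fixed. *)
have [n [[[[nb ns] nf] nhn] nun]] :=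
  filter_ex (filterI (filterI (filterI (filterI nOb nOs) nOf) nh) nu).
have minr_rho (x y : E) : frob (x - y) < rho ->
    [/\ `|x - y| < d1, `|x - y| < d2, `|x - y| < d3 & `|x - y| < d4].
  move=> xy; have := le_lt_trans (normr_le_frob _) xy.
  by rewrite /rho !lt_min => /andP[_ /andP[/andP[-> ->] /andP[-> ->]]].
have equi t x y : 0 <= t <= T -> sq1 x <= r -> sq1 y <= r -> frob (x - y) < rho ->
  [/\ `|un n t x - un n t y| <= eta, `|vn n t x - vn n t y| <= eta,
    `|hn n x - hn n y| <= eta &
    forall a z, `|a| <= A -> frob z <= N -> `|fn n t x a z - fn n t y a z| <= eta].
  move=> tT xr yr /minr_rho[xy1 xy2 xy3 xy4].
  have Bx := inball x xr; have By := inball y yr; split.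
  - exact/ltW/(d1P (n, t)).
  - exact/ltW/(d2P (n, t)).
  - exact/ltW/(d3P n).
  - move=> a z aA zN; apply/ltW.
    apply: (d4P (n, t) (x, a, z) (y, a, z) tT (inK x a z xr aA zN) (inK y a z yr
      aA zN)).
    have -> : (x, a, z) - (y, a, z) = (x - y, 0, 0).
      by rewrite -[RHS]/(_, _); congr (_, _, _); exact: subrr.
    rewrite prod_normE /= prod_normE /= !normr0 !gt_max xy4.
    by rewrite (le_lt_trans _ xy4).
have diffD t y : 0 <= t <= T -> sq1 y <= r ->
  [/\ frob (bn n t y - cn n t y) <= D t, frob (sn n t y - rn n t y) <= D t &
    forall a z, `|a| <= A -> frob z <= N -> fn n t y a z - gn n t y a z <= D t].
  move=> tT yr; have By := inball y yr; rewrite /D; case: asboolP => Ut; last first.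
    have [nb' ns' nf'] : [/\ ~ Ob t, ~ Os t & ~ Of t].
      by split=> H; apply: Ut; [left; left|left; right|right].
    split; [exact: nb|exact: ns|move=> a z aA zN].
    by apply: le_trans (ler_norm _) _; apply: nf => //; exact: inK.
  have yR := sq1_le_ball r1 yr; have y0 := frob_ge0 y.
  have Cy : C * (1 + frob y) <= C * (1 + r) by rewrite ler_wpM2l// lerD2l.
  have CN0 := mulr_ge0 C0 N0.
  have Cr0 : 0 <= C * (1 + r) by apply: le_trans Cy; rewrite mulr_ge0// addr_ge0.
  have Dmax1 : C * (1 + r) + C * (1 + r) <= Dmax.
    rewrite /Dmax -mulrA mulr_natl mulr2n lerDl mulr_ge0//.
    exact: addr_ge0.
  have PAy : P * sq1 y ^+ k <= A.
    rewrite ler_wpM2l// lerXn2r// nnegrE ?(le_trans ler01 r1)//.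
    exact: le_trans ler01 (sq1_ge1 y).
  split=> [||a z aA zN].
  - apply: le_trans (frobB _ _) _; apply: le_trans Dmax1; apply: lerD;
      apply: le_trans Cy; [exact: (growth_b (l1 n))|exact: (growth_b (l2 n))].
  - apply: le_trans (frobB _ _) _; apply: le_trans Dmax1; apply: lerD;
      apply: le_trans Cy; [exact: (growth_sigma (l1 n))|exact: (growth_sigma (l2 n))].
  have bnd (g : R -> E -> R -> E -> R) (b' : R -> E -> E) (s' : R -> E -> 'M[R]_d) :
      lipschitz_coefs T C b' s' g -> `|g t y 0 0| <= P * sq1 y ^+ k ->
      `|g t y a z| <= Kf + C * N.
    move=> lg g0; have := lip_f lg y a 0 z 0 tT; rewrite !subr0 => hl.
    exact: generator_bound_arith C0 hl g0 PAy aA zN.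
  have q1 := bnd _ _ _ (l1 n) (g1 n t y tT).2.
  have q2 := bnd _ _ _ (l2 n) (g2 n t y tT).2.
  apply: le_trans (ler_norm _) _; apply: le_trans (ler_normB _ _) _.
  apply: (le_trans (lerD q1 q2)).
  have -> : Kf + C * N + (Kf + C * N) = 2 * (Kf + C * N) by rewrite mulr_natl mulr2n.
  by rewrite /Dmax lerDr -mulrA mulr_ge0.
have M0 : 0 <= M := le_trans ler01 M1.
have DG t : M * ((3 / 2 * C + 2 * C ^+ 2) * (6 * eta)
    + eps^-1 * ((2 + C) * D t + D t ^+ 2) + eta + gam * S) < G t.
  rewrite /D /G; case: asboolP => Ut.
    by apply: error_arith Meta MS _ sgt tau0; rewrite lerDr ltW.
  by apply: error_arith Meta MS _ sgt tau0; rewrite addr0.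
have : doubled (un n) (vn n) F k mu gam A (2 * eps)^-1 del t0 x0 x0 < kap.
  apply: (@doubling_contradiction R d T C (bn n) (cn n) (sn n) (rn n) (fn n) (gn n)
    (hn n) (kn n) (un n) (vn n) C0 (l1 n) (l2 n) (cl1 n) (cl2 n) P k P0
    (fun t x tT => (g1 n t x tT).1) (fun t x tT => (g2 n t x tT).1)
    (fun t x tT => (g1 n t x tT).2) (fun t x tT => (g2 n t x tT).2)
    mu del r A Kf gam N rho eps eta zeta kap F D G mu0 (lexx _) del0 r1 rP
    (lexx _) A1 (lexx _) gam0 gam1 gamA NK N1 _ eps01 epsA (ltW eta0) equi _ Fc _ _
    diffD _ (fun t _ => DG t) kap0 _ t0 x0 t0T).
  - by rewrite rho0.
  - by move=> t /F0/andP[].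
  - by move=> t _; exact: FG.
  - by move=> t; rewrite /D; case: asboolP => // _; exact: ltW.
  - by move=> y yr; apply: le_trans (ler_norm _) _; apply: nhn; exact: inball.
  - have CC : 0 <= M * ((3 / 2 * C + 2 * C ^+ 2) * (6 * eta)).
      rewrite mulr_ge0// mulr_ge0 ?mulr_ge0 ?(ltW eta0)//.
      by rewrite addr_ge0 ?mulr_ge0 ?sqr_ge0// divr_ge0.
    exact: terminal_arith CC Meta Mz MgA sgk kap0.
rewrite ltNge => /negP; apply.
rewrite /doubled delE subrr dotvv frob0 expr0n/= mulr0 subr0.
have a1 : 1 <= expR (mu * t0).
  by apply: le_trans (expR_ge1Dx _); rewrite lerDl mulr_ge0//; case/andP: t0T.
have g0 : 0 <= gam * (vn n t0 x0 - A) ^+ 2 by rewrite mulr_ge0 ?sqr_ge0// ltW.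
have W2 : 2 * kap <= un n t0 x0 - vn n t0 x0 + gam * (vn n t0 x0 - A) ^+ 2.
  by rewrite -[2 * kap]addr0 lerD// ltW.
have /andP[_] := F0 t0 t0T; rewrite tauT => Ft0.
exact: initial_arith a1 (ltW kap0) W2 Ft0 e0E.
Qed.

End Comparison.

Theorem corollary2p11 (R : realType) (d : nat) (hd : (1 <= d)%N)
    (T : R) (hT : 0 < T)
    (b : R -> 'cV[R]_d -> 'cV[R]_d)
    (sigma : R -> 'cV[R]_d -> 'M[R]_d)
    (f : R -> 'cV[R]_d -> R -> 'cV[R]_d -> R)
    (h : 'cV[R]_d -> R)
    (hadm : admissible T b sigma f h) :
  (forall ucheck uhat : R -> 'cV[R]_d -> R,
     sv_subsolution T b sigma f h ucheck ->
     sv_supersolution T b sigma f h uhat ->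
     forall (t : R) (x : 'cV[R]_d), 0 <= t <= T -> ucheck t x <= uhat t x)
  /\
  (forall u v : R -> 'cV[R]_d -> R,
     generalized_sv_solution T b sigma f h u ->
     generalized_sv_solution T b sigma f h v ->
     forall (t : R) (x : 'cV[R]_d), 0 <= t <= T -> u t x = v t x).
Proof.
split=> [ucheck uhat sub super|u v [usup usub] [vsup vsub]] t x tT.
  exact: (comparison hT sub super x tT).
by apply: le_anti; rewrite (comparison hT usub vsup x tT) (comparison hT vsub usup x tT).
Qed.
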